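(* Let $\mathcal D\subset\mathbb R^2$ be a domain, $(u_0,v_0)\in\mathcal D$, and let $\nu_1(u,v),\nu_2(u,v),\gamma_1(u,v),\gamma_2(u,v)$, $(u,v)\in\mathcal D$, be four smooth functions satisfying the following conditions on $\mathcal D$: 1) $\nu_1-\nu_2>0,\quad \gamma_1\,(\nu_1)_v>0,\quad \gamma_2\,(\nu_2)_u>0$; 2.1) $\displaystyle \left(\ln\frac{(\nu_1)_v}{\gamma_1}\right)_u=\frac{(\nu_1)_u}{\nu_1-\nu_2},\qquad \left(\ln\frac{(\nu_2)_u}{\gamma_2}\right)_v=-\frac{(\nu_2)_v}{\nu_1-\nu_2}$; 2.2) $\displaystyle \frac{\nu_1-\nu_2}{2}\left(\frac{(\gamma_1^2)_v}{(\nu_1)_v}-\frac{(\gamma_2^2)_u}{(\nu_2)_u}\right)-(\gamma_1^2+\gamma_2^2)=1+\nu_1\nu_2$. Let $l_0X_0Y_0N_0$ be a right oriented orthonormal frame of $\mathbb R^4$. Then there exist a domain $\mathcal D_0$ with $(u_0,v_0)\in\mathcal D_0\subset\mathcal D$ and a unique strongly regular surface $\mathcal M:\ z=l(u,v)$, $(u,v)\in\mathcal D_0$, in $\mathbb S^3$ such that (i) $(u,v)$ are principal parameters; (ii) $l(u_0,v_0)=l_0,\ X(u_0,v_0)=X_0,\ Y(u_0,v_0)=Y_0,\ N(u_0,v_0)=N_0$; (iii) the invariants of $\mathcal M$ are the given functions $\nu_1,\nu_2,\gamma_1,\gamma_2$.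
   Context: $\mathbb S^3$ is the unit sphere centered at the origin of $\mathbb R^4$. Let $\mathcal M:\ z=l(u,v)$ be a smooth regular surface in $\mathbb S^3$ (so $l$ takes values in $\mathbb S^3\subset\mathbb R^4$), with $N$ a smooth unit normal vector field of $\mathcal M$ in $\mathbb S^3$ (tangent to $\mathbb S^3$ and orthogonal to $l_u,l_v$), and with coefficients $E=\langle z_u,z_u\rangle$, $F=\langle z_u,z_v\rangle$, $G=\langle z_v,z_v\rangle$ and $e=\langle z_{uu},N\rangle$, $f=\langle z_{uv},N\rangle$, $g=\langle z_{vv},N\rangle$ of its first and second fundamental forms in $\mathbb S^3$. The parameters $(u,v)$ are called principal if $\mathcal M$ has no umbilical points and $F=f=0$, i.e. the parametric lines are the principal lines. With respect to principal parameters one sets $X=z_u/\sqrt E$, $Y=z_v/\sqrt G$, and the four invariants of $\mathcal M$ are the principal normal curvatures $\nu_1=e/E$, $\nu_2=g/G$ and the principal geodesic curvatures (geodesic curvatures of the principal lines) $\gamma_1=-\dfrac{E_v}{2E\sqrt G}$, $\gamma_2=\dfrac{G_u}{2G\sqrt E}$. The surface, parameterized by principal parameters, is called strongly regular if $(\nu_1-\nu_2)\gamma_1\gamma_2\neq 0$ everywhere. Subscripts $u,v$ denote partial derivatives. Uniqueness is understood for the surface over the (sufficiently small) neighborhood $\mathcal D_0$ of $(u_0,v_0)$. *)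

(* Defs.v *)
From mathcomp Require Import all_boot all_algebra Rstruct.
From Stdlib Require Import Reals.
From Coquelicot Require Import Coquelicot.

Set Implicit Arguments.
Unset Strict Implicit.
Unset Printing Implicit Defensive.

(* [ring_scope] is open only for the matrix notations; scalar formulas are read
   in [R_scope]. *)
Local Open Scope ring_scope.
Local Open Scope R_scope.

Definition connected_set (D : R * R -> Prop) : Prop :=
  forall U V : R * R -> Prop, open U -> open V ->
    (forall p, D p -> U p \/ V p) ->
    (exists p, D p /\ U p) -> (exists p, D p /\ V p) ->
    exists p, D p /\ U p /\ V p.

(* Nonemptiness is not required here: in the theorem every domain contains a
   given point. *)
Definition is_domain (D : R * R -> Prop) : Prop := open D /\ connected_set D.

Definition Du (f : R -> R -> R) (u v : R) : R := Derive (fun t => f t v) u.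
Definition Dv (f : R -> R -> R) (u v : R) : R := Derive (fun t => f u t) v.

(* [ex_diff_n f n u v] asks that the partial derivatives of [f] of all orders
   up to [n] exist and be continuous at [(u, v)]; on an open set, holding this
   for all [n] and all points is being of class C^oo. *)
Definition smooth_on (D : R * R -> Prop) (f : R -> R -> R) : Prop :=
  forall n u v, D (u, v) -> ex_diff_n f n u v.

Notation R4 := 'rV[R]_4.

Definition dot (x y : R4) : R := \sum_(i < 4) (x ord0 i * y ord0 i).

Definition vDu (z : R -> R -> R4) (u v : R) : R4 :=
  \row_i Du (fun s t => z s t ord0 i) u v.
Definition vDv (z : R -> R -> R4) (u v : R) : R4 :=
  \row_i Dv (fun s t => z s t ord0 i) u v.

Definition vsmooth_on (D : R * R -> Prop) (z : R -> R -> R4) : Prop :=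
  forall i : 'I_4, smooth_on D (fun u v => z u v ord0 i).

Definition frame_mx (a b c d : R4) : 'M[R]_4 :=
  \matrix_(i < 4) tnth [tuple a; b; c; d] i.

Definition right_oriented_orthonormal (a b c d : R4) : Prop :=
  let M := frame_mx a b c d in
  (forall i j : 'I_4, dot (row i M) (row j M) = if i == j then 1 else 0) /\
  0 < \det M.

Record regular_surface_in_S3 (D : R * R -> Prop) (l N : R -> R -> R4) : Prop := {
  surf_smooth : vsmooth_on D l;
  surf_sphere : forall u v, D (u, v) -> dot (l u v) (l u v) = 1;
  surf_regular : forall u v, D (u, v) ->
    row_free (col_mx (vDu l u v) (vDv l u v));
  normal_smooth : vsmooth_on D N;
  normal_unit : forall u v, D (u, v) -> dot (N u v) (N u v) = 1;
  normal_tangent_S3 : forall u v, D (u, v) -> dot (N u v) (l u v) = 0;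
  normal_u : forall u v, D (u, v) -> dot (N u v) (vDu l u v) = 0;
  normal_v : forall u v, D (u, v) -> dot (N u v) (vDv l u v) = 0
}.

Section Invariants.

Variables l N : R -> R -> R4.

Definition first_E (u v : R) : R := dot (vDu l u v) (vDu l u v).
Definition first_F (u v : R) : R := dot (vDu l u v) (vDv l u v).
Definition first_G (u v : R) : R := dot (vDv l u v) (vDv l u v).

Definition second_e (u v : R) : R := dot (vDu (vDu l) u v) (N u v).
Definition second_f (u v : R) : R := dot (vDv (vDu l) u v) (N u v).
Definition second_g (u v : R) : R := dot (vDv (vDv l) u v) (N u v).

Definition frameX (u v : R) : R4 := (/ sqrt (first_E u v)) *: vDu l u v.
Definition frameY (u v : R) : R4 := (/ sqrt (first_G u v)) *: vDv l u v.

Definition normal_curv1 (u v : R) : R := second_e u v / first_E u v.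
Definition normal_curv2 (u v : R) : R := second_g u v / first_G u v.
Definition geod_curv1 (u v : R) : R :=
  - (Dv first_E u v / (2 * first_E u v * sqrt (first_G u v))).
Definition geod_curv2 (u v : R) : R :=
  Du first_G u v / (2 * first_G u v * sqrt (first_E u v)).

Definition umbilic (u v : R) : Prop :=
  exists k : R, second_e u v = k * first_E u v /\ second_f u v = k * first_F u v /\
                second_g u v = k * first_G u v.

Definition principal_parameters (D : R * R -> Prop) : Prop :=
  forall u v, D (u, v) ->
    ~ umbilic u v /\ first_F u v = 0 /\ second_f u v = 0.

Definition strongly_regular (D : R * R -> Prop) : Prop :=
  forall u v, D (u, v) ->
    (normal_curv1 u v - normal_curv2 u v) * geod_curv1 u v * geod_curv2 u v <> 0.

End Invariants.

(* The surface is the map [l] on [D0]; its unit normal field is chosen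
   together with it, the choice of sign being fixed by the frame at the base
   point. *)
Definition surface_with_invariants (D0 : R * R -> Prop) (u0 v0 : R)
    (l0 X0 Y0 N0 : R4) (nu1 nu2 g1 g2 : R -> R -> R) (l : R -> R -> R4) : Prop :=
  exists N : R -> R -> R4,
    regular_surface_in_S3 D0 l N /\
    principal_parameters l N D0 /\
    strongly_regular l N D0 /\
    (l u0 v0 = l0 /\ frameX l u0 v0 = X0 /\ frameY l u0 v0 = Y0 /\
     N u0 v0 = N0) /\
    (forall u v, D0 (u, v) ->
       normal_curv1 l N u v = nu1 u v /\ normal_curv2 l N u v = nu2 u v /\
       geod_curv1 l u v = g1 u v /\ geod_curv2 l u v = g2 u v).

(* Main.v *)
Require Import Defs.
From mathcomp Require Import all_boot all_algebra Rstruct.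
From Stdlib Require Import Reals Lra.
From Stdlib Require ClassicalEpsilon.
From Coquelicot Require Import Coquelicot.

(** Write [p = sqrt E] and [q = sqrt G].  The Codazzi equations
    [(nu1)_v = (nu1 - nu2) g1 q] and [(nu2)_u = (nu1 - nu2) g2 p] can be solved for
    [p] and [q], so the four invariants already determine the metric.  With these [p]
    and [q], the two conditions on logarithmic derivatives become [p_v = - g1 p q] and
    [q_u = g2 p q], which says that [g1] and [g2] are the geodesic curvatures of the
    coordinate lines of the metric [p^2 du^2 + q^2 dv^2], and the remaining condition
    becomes the Gauss equation ([codazzi_gauss_of_invariants]).

    A surface with these invariants amounts to an orthonormal frame [Z = (l, X, Y, N)]
    solving a linear system [Z_u = A Z], [Z_v = B Z] with skew matrices [A], [B] built
    from [p], [q] and the invariants.  The compatibility condition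
    [A_v + A B = B_u + B A] is exactly the Codazzi and Gauss equations together with
    the two formulas for [p_v] and [q_u] ([conn_flat]).

    Existence.  A compatible system is solved along the line [v = v0] and then along
    every line [u = const] ([flow]).  The point is that the result [Z] is differentiable
    in [u] with [Z_u = A Z].  Since the candidate [A Z] for the derivative is known in
    advance, this can be checked directly: by compatibility the difference
    [Z(u + h, v) - Z(u, v) - h A Z(u, v)] solves the skew system [x_v = B x] up to a
    source of size [O(h^2)], with an initial value [o(h)] on the line [v = v0].  As [B] is skew, the length of a solution grows at most by the
    integral of the source ([skew_energy_estimate]), so the difference is [o(h)]
    uniformly ([flow_increment], [flow_derive_u]).  The equations then give smoothness
    by induction on the order ([smooth_of_linear_system]), skewness keeps the frame
    orthonormal ([frame_equations_orthonormal]), and the invariants of [l] are read off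
    the equations ([surface_of_frame]).

    Uniqueness.  For a surface with the given invariants, Rodrigues' formulas
    [N_u = - nu1 l_u] and [N_v = - nu2 l_v] and the symmetry of the mixed derivatives of
    [N] express [l_uv] through [l_u] and [l_v]; this gives back the Codazzi equations
    and forces [sqrt E = p], [sqrt G = q].  Its frame therefore solves the same system
    ([surface_frame_equations]) with the same initial value, and the difference of two
    solutions of a skew system has constant length ([frame_equations_unique]). *)

Set Implicit Arguments.
Unset Strict Implicit.
Unset Printing Implicit Defensive.
Local Open Scope ring_scope.
Local Open Scope R_scope.

(** * Finite sums of reals *)

(** The summands of a ring sum are parsed in the ring scope; this alias keeps the
    operations of the standard reals in them, as the arithmetic tactics expect. *)
Definition rsum n (F : 'I_n -> R) : R := \sum_(i < n) F i.

Notation "'\rsum_' ( i < n ) F" := (rsum (fun i : 'I_n => F))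
  (at level 34, F at level 41, i, n at level 50, format "'[' \rsum_ ( i  <  n ) '/  '  F ']'") : R_scope.

Section RealSums.

Variable n : nat.
Implicit Types F G : 'I_n -> R.

Lemma Rsum_ind (P : R -> Prop) F :
  P 0 -> (forall x y, P x -> P y -> P (x + y)) -> (forall i, P (F i)) ->
  P (\rsum_(i < n) F i).
Proof. by move=> P0 PD PF; apply: big_ind => // i _; apply: PF. Qed.

Lemma Rsum_ind2 (P : R -> R -> Prop) F G :
  P 0 0 -> (forall x1 x2 y1 y2, P x1 x2 -> P y1 y2 -> P (x1 + y1) (x2 + y2)) ->
  (forall i, P (F i) (G i)) -> P (\rsum_(i < n) F i) (\rsum_(i < n) G i).
Proof. by move=> P0 PD PF; apply: big_ind2 => // i _; apply: PF. Qed.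

Lemma eq_Rsum F G : (forall i, F i = G i) -> \rsum_(i < n) F i = \rsum_(i < n) G i.
Proof. by move=> FG; apply: eq_bigr => i _. Qed.

Lemma Rsum_mull c F : c * \rsum_(i < n) F i = \rsum_(i < n) (c * F i).
Proof. exact: GRing.mulr_sumr. Qed.

Lemma Rsum_add F G :
  \rsum_(i < n) F i + \rsum_(i < n) G i = \rsum_(i < n) (F i + G i).
Proof. by symmetry; exact: big_split. Qed.

Lemma Rsum_opp F : - \rsum_(i < n) F i = \rsum_(i < n) (- F i).
Proof. by symmetry; exact: GRing.sumrN. Qed.

Lemma Rsum_sub F G :
  \rsum_(i < n) F i - \rsum_(i < n) G i = \rsum_(i < n) (F i - G i).
Proof. by rewrite /Rminus Rsum_opp Rsum_add. Qed.

Lemma Rsum_zero F : (forall i, F i = 0) -> \rsum_(i < n) F i = 0.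
Proof. by move=> F0; apply: big1 => i _. Qed.

Lemma Rsum_exchange (H : 'I_n -> 'I_n -> R) :
  \rsum_(i < n) \rsum_(j < n) H i j = \rsum_(i < n) \rsum_(j < n) H j i.
Proof. exact: exchange_big. Qed.

Lemma Rsum_ge0 F : (forall i, 0 <= F i) -> 0 <= \rsum_(i < n) F i.
Proof. by move=> F0; apply: Rsum_ind => //; [lra | move=> x y; lra]. Qed.

Lemma Rsum_le F G :
  (forall i, F i <= G i) -> \rsum_(i < n) F i <= \rsum_(i < n) G i.
Proof.
by move=> FG; apply: Rsum_ind2 => // [|x1 x2 y1 y2 h1 h2]; [lra | exact: Rplus_le_compat].
Qed.

Lemma Rsum_const c : \rsum_(i < n) c = INR n * c.
Proof.
rewrite /rsum big_const_ord; elim: (n) => [|m IHm]; first by rewrite /= Rmult_0_l.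
by rewrite iterS IHm S_INR Rmult_plus_distr_r Rmult_1_l Rplus_comm.
Qed.

Lemma Rsum_le_const F c : (forall i, F i <= c) -> \rsum_(i < n) F i <= INR n * c.
Proof. by rewrite -Rsum_const; exact: Rsum_le. Qed.

Lemma Rabs_sum F : Rabs (\rsum_(i < n) F i) <= \rsum_(i < n) Rabs (F i).
Proof.
apply: (Rsum_ind2 (P := fun x y => Rabs x <= y)) => [|x1 x2 y1 y2 h1 h2|i].
- by rewrite Rabs_R0; lra.
- exact: Rle_trans (Rabs_triang _ _) (Rplus_le_compat _ _ _ _ h1 h2).
- exact: Rle_refl.
Qed.

Lemma Rsum_sqr_le F : \rsum_(i < n) (F i * F i) <= (\rsum_(i < n) Rabs (F i)) ^ 2.
Proof.
suff [] : \rsum_(i < n) (F i * F i) <= (\rsum_(i < n) Rabs (F i)) ^ 2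
          /\ 0 <= \rsum_(i < n) Rabs (F i) by [].
apply: (Rsum_ind2 (P := fun x y => x <= y ^ 2 /\ 0 <= y)).
- by split; [rewrite /=; lra | lra].
- by move=> x1 y1 x2 y2 [h1 p1] [h2 p2]; split; nra.
- move=> i; split; last exact: Rabs_pos.
  by rewrite -Rsqr_pow2 -Rsqr_abs /Rsqr; exact: Rle_refl.
Qed.

Lemma Rsum_ge_term F i : (forall j, 0 <= F j) -> F i <= \rsum_(j < n) F j.
Proof.
move=> F0; rewrite /rsum (bigD1 i) //= -[X in X <= _]Rplus_0_r; apply: Rplus_le_compat_l.
apply: (big_ind (fun x => 0 <= x)) => [|x y h1 h2|j _]; [exact: Rle_refl| |exact: F0].
exact: Rplus_le_le_0_compat.
Qed.

Lemma Rsum_assoc (x : 'I_n -> R) (P : 'I_n -> 'I_n -> R) (y : 'I_n -> R) :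
  \rsum_(b < n) (x b * \rsum_(d < n) (P b d * y d))
  = \rsum_(d < n) ((\rsum_(b < n) (x b * P b d)) * y d).
Proof.
rewrite (eq_Rsum (G := fun b => \rsum_(d < n) (x b * P b d * y d))); last first.
  by move=> b; rewrite Rsum_mull; apply: eq_Rsum => d; ring.
rewrite Rsum_exchange; apply: eq_Rsum => d; rewrite [RHS]Rmult_comm Rsum_mull.
by apply: eq_Rsum => b; ring.
Qed.

Lemma Rabs_lin_le (C x : 'I_n -> R) k m :
  (forall b, Rabs (C b) <= k) -> (forall b, Rabs (x b) <= m) ->
  Rabs (\rsum_(b < n) (C b * x b)) <= INR n * (k * m).
Proof.
move=> Ck xm; apply: Rle_trans (Rabs_sum _) _; apply: Rsum_le_const => b.
by rewrite Rabs_mult; apply: Rmult_le_compat; try exact: Rabs_pos.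
Qed.

Lemma is_derive_Rsum (F : 'I_n -> R -> R) t (d : 'I_n -> R) :
  (forall i, is_derive (F i) t (d i)) ->
  is_derive (fun s => \rsum_(i < n) F i s) t (\rsum_(i < n) d i).
Proof.
move=> Fd.
suff : is_derive ((fun r s => \sum_(i <- r) F i s) (index_enum 'I_n)) t
   (\sum_(i <- index_enum 'I_n) d i) by [].
elim: (index_enum _) => [|i r IHr].
  rewrite big_nil; apply: (is_derive_ext (fun=> 0)) => [s|]; first by rewrite big_nil.
  exact: is_derive_const.
rewrite big_cons.
apply: (is_derive_ext (fun s => F i s + \sum_(i <- r) F i s)) => [s|].
  by rewrite big_cons.
exact: is_derive_plus.
Qed.

Lemma continuous_Rsum (F : 'I_n -> R -> R) t :
  (forall i, continuous (F i) t) ->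
  continuous (fun s => \rsum_(i < n) F i s) t.
Proof.
move=> Fc.
suff : continuous ((fun r s => \sum_(i <- r) F i s) (index_enum 'I_n)) t by [].
elim: (index_enum _) => [|i r IHr].
  apply: (continuous_ext (fun=> 0)) => [s|]; first by rewrite big_nil.
  exact: continuous_const.
apply: (continuous_ext (fun s => F i s + \sum_(i <- r) F i s)) => [s|].
  by rewrite big_cons.
exact: (@continuous_plus _ _ R_NormedModule).
Qed.

End RealSums.

(** * Linear systems of ordinary differential equations *)

Lemma lipschitz_of_derive (f df : R -> R) a b K :
  (forall t, Rmin a b <= t <= Rmax a b -> is_derive f t (df t)) ->
  (forall t, Rmin a b <= t <= Rmax a b -> Rabs (df t) <= K) ->
  Rabs (f b - f a) <= K * Rabs (b - a).
Proof.
move=> fd dK; case: (@MVT_gen f a b df) => [t ht|t ht|c [hc ->]].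
- by apply: fd; lra.
- apply/continuity_pt_filterlim.
  exact: (ex_derive_continuous (V := R_NormedModule)) (ex_intro _ _ (fd t ht)).
- by rewrite Rabs_mult; apply: Rmult_le_compat_r (Rabs_pos _) (dK c hc).
Qed.

Lemma between_dist a b c x r :
  Rabs (a - c) < r -> Rabs (b - c) < r -> Rmin a b <= x <= Rmax a b ->
  Rabs (x - c) < r.
Proof.
move=> /Rabs_def2 ha /Rabs_def2 hb; rewrite /Rmin /Rmax.
by case: Rle_dec => hab hx; apply: Rabs_def1; lra.
Qed.

Lemma ball_interval_locally c r x : Rabs (x - c) < r ->
  locally x (fun y => Rabs (y - c) < r).
Proof.
move=> hx; have d0 : 0 < r - Rabs (x - c) by lra.
exists (mkposreal _ d0) => y hy.
have {}hy : Rabs (y - x) < r - Rabs (x - c) by exact: hy.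
by have := Rabs_triang (y - x) (x - c); rewrite (_ : y - x + (x - c) = y - c); [lra | ring].
Qed.

Section Picard.

Variables (n : nat) (a : 'I_n -> 'I_n -> R -> R) (t0 : R) (c : 'I_n -> R).

Definition lin_rhs (x : 'I_n -> R -> R) (i : 'I_n) (t : R) : R :=
  \rsum_(j < n) (a i j t * x j t).

Fixpoint picard (k : nat) (i : 'I_n) (t : R) : R :=
  if k is k'.+1 then c i + RInt (lin_rhs (picard k') i) t0 t else c i.

(** The solution is an explicit limit, so that it is a function of all the parameters of
    the system at once. *)
Definition lin_flow (i : 'I_n) (t : R) : R := real (Lim_seq (fun k => picard k i t)).

Variables (r K : R).
Hypothesis r_gt0 : 0 < r.
Hypothesis a_cont : forall i j t, Rabs (t - t0) < r -> continuous (a i j) t.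
Hypothesis a_bound : forall i j t, Rabs (t - t0) < r -> Rabs (a i j t) <= K.
Hypothesis small : INR n * K * r <= / 2.

Lemma center_in_ball : Rabs (t0 - t0) < r.
Proof. by rewrite Rminus_diag Rabs_R0. Qed.

Lemma lin_rhs_continuous x i t :
  (forall j s, Rabs (s - t0) < r -> continuous (x j) s) ->
  Rabs (t - t0) < r -> continuous (lin_rhs x i) t.
Proof.
move=> xc ht; apply: continuous_Rsum => j.
by apply: (@continuous_mult _ R_AbsRing); [exact: a_cont | exact: xc].
Qed.

Lemma lin_rhs_ex_RInt x i t :
  (forall j s, Rabs (s - t0) < r -> continuous (x j) s) ->
  Rabs (t - t0) < r -> ex_RInt (lin_rhs x i) t0 t.
Proof.
move=> xc ht; apply: (@ex_RInt_continuous R_CompleteNormedModule) => s hs.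
by apply: lin_rhs_continuous => //; exact: between_dist center_in_ball ht hs.
Qed.

Lemma lin_rhs_RInt_derive x i t :
  (forall j s, Rabs (s - t0) < r -> continuous (x j) s) ->
  Rabs (t - t0) < r ->
  is_derive (fun s => c i + RInt (lin_rhs x i) t0 s) t (lin_rhs x i t).
Proof.
move=> xc ht; rewrite -[X in is_derive _ _ X]Rplus_0_l.
apply: (@is_derive_plus _ R_NormedModule); first exact: is_derive_const.
apply: (is_derive_RInt (V := R_NormedModule) _ _ t0); last exact: lin_rhs_continuous.
apply: filter_imp (ball_interval_locally ht) => s hs.
by apply: (RInt_correct (V := R_CompleteNormedModule)); exact: lin_rhs_ex_RInt.
Qed.

Lemma picard_continuous k i t : Rabs (t - t0) < r -> continuous (picard k i) t.
Proof.
elim: k i t => [|k IHk] i t ht /=; first exact: continuous_const.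
apply: (ex_derive_continuous (V := R_NormedModule)).
by eexists; exact: lin_rhs_RInt_derive.
Qed.

(** Smallness of the interval, [n K r <= 1/2], makes one Picard step halve the uniform
    distance. *)
Lemma picard_contraction x y i t eps :
  (forall j s, Rabs (s - t0) < r -> continuous (x j) s) ->
  (forall j s, Rabs (s - t0) < r -> continuous (y j) s) ->
  (forall j s, Rabs (s - t0) < r -> Rabs (x j s - y j s) <= eps) ->
  Rabs (t - t0) < r ->
  Rabs (RInt (lin_rhs x i) t0 t - RInt (lin_rhs y i) t0 t) <= eps / 2.
Proof.
move=> xc yc xy ht.
have eps0 : 0 <= eps.
  exact: Rle_trans (Rabs_pos _) (xy i t0 center_in_ball).
have K0 : 0 <= K := Rle_trans _ _ _ (Rabs_pos _) (a_bound i i center_in_ball).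
have -> : RInt (lin_rhs x i) t0 t - RInt (lin_rhs y i) t0 t
        = RInt (fun s => lin_rhs x i s - lin_rhs y i s) t0 t.
  by symmetry; apply: (RInt_minus (V := R_CompleteNormedModule)); exact: lin_rhs_ex_RInt.
have bd s : Rabs (s - t0) < r -> Rabs (lin_rhs x i s - lin_rhs y i s) <= INR n * K * eps.
  move=> hs; rewrite Rsum_sub Rmult_assoc; apply: Rle_trans (Rabs_sum _) _.
  apply: Rsum_le_const => j /=; rewrite -Rmult_minus_distr_l Rabs_mult.
  apply: Rmult_le_compat; try exact: Rabs_pos; [exact: a_bound | exact: xy].
have exd : ex_RInt (fun s => lin_rhs x i s - lin_rhs y i s) t0 t.
  by apply: (@ex_RInt_minus R_NormedModule); exact: lin_rhs_ex_RInt.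
have C0 : 0 <= INR n * K * eps.
  by apply: Rmult_le_pos => //; apply: Rmult_le_pos => //; exact: pos_INR.
apply: (Rle_trans _ (Rabs (t - t0) * (INR n * K * eps))).
  have [le_t|lt_t] := Rle_lt_dec t0 t.
    rewrite (Rabs_pos_eq (t - t0)); last lra.
    apply: abs_RInt_le_const => // s hs; apply: bd.
    by apply: between_dist center_in_ball ht _; rewrite Rmin_left // Rmax_right.
  rewrite -(opp_RInt_swap (V := R_CompleteNormedModule)) //; last exact: (@ex_RInt_swap R_NormedModule).
  rewrite /opp /= Rabs_Ropp Rabs_minus_sym (Rabs_pos_eq (t0 - t)); last lra.
  apply: abs_RInt_le_const; [lra | exact: (@ex_RInt_swap R_NormedModule) |] => s hs; apply: bd.
  by apply: between_dist center_in_ball ht _; rewrite Rmin_right ?Rmax_left; lra.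
apply: (Rle_trans _ (r * (INR n * K * eps))).
  by apply: Rmult_le_compat_r => //; lra.
rewrite (_ : r * _ = INR n * K * r * eps); last ring.
have := Rmult_le_compat_r eps _ _ eps0 small; lra.
Qed.

Lemma lin_rhs_const_bound i t :
  Rabs (t - t0) < r -> Rabs (RInt (lin_rhs (fun j _ => c j) i) t0 t)
    <= (\rsum_(j < n) Rabs (c j)) / 2.
Proof.
move=> ht.
have := @picard_contraction (fun j _ => c j) (fun _ _ => 0) i t (\rsum_(j < n) Rabs (c j)).
have -> : RInt (lin_rhs (fun _ _ => 0) i) t0 t = 0.
  rewrite (RInt_ext _ (fun=> 0)) => [|s _]; last by apply: Rsum_zero => j; ring.
  by rewrite RInt_const /scal /= /mult /= Rmult_0_r.
rewrite Rminus_0_r; apply => // [j s _|j s _|j s _]; try exact: continuous_const.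
by rewrite Rminus_0_r; apply: (@Rsum_ge_term n (fun j => Rabs (c j))) => k; exact: Rabs_pos.
Qed.

Let M := \rsum_(j < n) Rabs (c j).

Lemma picard_step k i t : Rabs (t - t0) < r ->
  Rabs (picard k.+1 i t - picard k i t) <= M * (/ 2) ^ k.+1.
Proof.
elim: k i t => [|k IHk] i t ht.
  rewrite /= (_ : c i + _ - c i = RInt (lin_rhs (fun j _ => c j) i) t0 t); last ring.
  by have := lin_rhs_const_bound i ht; rewrite -/M; lra.
rewrite (_ : _ - _ = RInt (lin_rhs (picard k.+1) i) t0 t - RInt (lin_rhs (picard k) i) t0 t);
  last by rewrite /=; ring.
rewrite (_ : M * _ = M * (/ 2) ^ k.+1 / 2); last by rewrite /=; lra.
by apply: picard_contraction => // j s hs; exact: picard_continuous.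
Qed.

Lemma picard_dist (k m : nat) i t : Rabs (t - t0) < r ->
  Rabs (picard (k + m)%nat i t - picard k i t) <= M * (/ 2) ^ k * (1 - (/ 2) ^ m).
Proof.
move=> ht; elim: m => [|m IHm].
  by rewrite addn0 Rminus_diag Rabs_R0 /=; lra.
have := picard_step (k + m)%nat i ht; rewrite addnS => hs.
have := Rabs_triang (picard (k + m)%nat.+1 i t - picard (k + m)%nat i t)
                    (picard (k + m)%nat i t - picard k i t).
rewrite (_ : _ + _ = picard (k + m)%nat.+1 i t - picard k i t); last ring.
move=> htr; apply: Rle_trans htr _; apply: Rle_trans (Rplus_le_compat _ _ _ _ hs IHm) _.
by rewrite -addnS -plusE pow_add /=; lra.
Qed.

Lemma M_ge0 : 0 <= M.
Proof. by apply: Rsum_ge0 => j; exact: Rabs_pos. Qed.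

Lemma half_pow_bound k : 0 < (/ 2) ^ k.
Proof. by apply: pow_lt; lra. Qed.

Lemma picard_dist_le k m i t : Rabs (t - t0) < r -> (k <= m)%nat ->
  Rabs (picard m i t - picard k i t) <= M * (/ 2) ^ k.
Proof.
move=> ht km; have := picard_dist k (m - k)%nat i ht; rewrite subnKC //.
have := half_pow_bound (m - k)%nat; have := half_pow_bound k; have := M_ge0.
set x := M; set y := _ ^ k; set z := _ ^ (_ - _)%nat => x0 y0 z0.
have := Rmult_le_pos _ _ (Rmult_le_pos _ _ x0 (Rlt_le _ _ y0)) (Rlt_le _ _ z0); lra.
Qed.

Lemma half_pow_small (C eps : R) : 0 < eps -> exists k, C * (/ 2) ^ k < eps.
Proof.
move=> eps0.
have C0 : 0 < Rabs C + 1 by have := Rabs_pos C; lra.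
have [N hN] := pow_lt_1_zero (/ 2) (ltac:(rewrite Rabs_pos_eq; lra))
  (eps / (Rabs C + 1)) (Rdiv_lt_0_compat _ _ eps0 C0).
exists N; have /= := hN N (le_n N); rewrite Rabs_pos_eq; last by have := half_pow_bound N; lra.
move=> /(Rmult_lt_compat_l _ _ _ C0); rewrite (_ : _ * (eps / _) = eps); last by field; lra.
have := half_pow_bound N; have := Rle_abs C; nra.
Qed.

Lemma picard_cv i t : Rabs (t - t0) < r ->
  is_lim_seq (fun k => picard k i t) (lin_flow i t).
Proof.
move=> ht; apply: Lim_seq_correct'; apply/ex_lim_seq_cauchy_corr => eps.
have [k hk] := half_pow_small (2 * M) (cond_pos eps); exists k => m1 m2 /leP h1 /leP h2.
have := picard_dist_le i ht h1; have := picard_dist_le i ht h2.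
have := Rabs_triang (picard m1 i t - picard k i t) (picard k i t - picard m2 i t).
rewrite (Rabs_minus_sym (picard k i t)) (_ : _ + _ = picard m1 i t - picard m2 i t); [lra|ring].
Qed.

Lemma picard_flow_dist k i t : Rabs (t - t0) < r ->
  Rabs (lin_flow i t - picard k i t) <= M * (/ 2) ^ k.
Proof.
move=> ht.
have cv : is_lim_seq (fun m => Rabs (picard (m + k)%coq_nat i t - picard k i t))
                     (Rabs (lin_flow i t - picard k i t)).
  apply: (is_lim_seq_abs _ (Finite _)).
  apply: is_lim_seq_minus'; last exact: is_lim_seq_const.
  by apply (proj1 (is_lim_seq_incr_n (fun m => picard m i t) k _)); exact: picard_cv.
apply: (is_lim_seq_le _ _ _ (Finite _) _ cv (is_lim_seq_const _)) => m.
by apply: picard_dist_le => //; rewrite plusE leq_addl.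
Qed.

Lemma lin_flow_continuous i t : Rabs (t - t0) < r -> continuous (lin_flow i) t.
Proof.
move=> ht; apply/filterlim_locally => eps.
have e3 : 0 < eps / 3 by have := cond_pos eps; lra.
have [k hk] := half_pow_small M e3.
have /filterlim_locally /(_ (mkposreal _ e3)) near_t := @picard_continuous k i t ht.
apply: filter_imp (filter_and _ _ near_t (ball_interval_locally ht)) => s [hks hs].
have {}hks : Rabs (picard k i s - picard k i t) < eps / 3 by exact: hks.
 change (Rabs (lin_flow i s - lin_flow i t) < eps).
have := picard_flow_dist k i hs; have := picard_flow_dist k i ht.
have := Rabs_triang (lin_flow i s - picard k i s) (picard k i s - lin_flow i t).
have := Rabs_triang (picard k i s - picard k i t) (picard k i t - lin_flow i t).
rewrite (Rabs_minus_sym (picard k i t)).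
rewrite (_ : _ - _ + (_ - lin_flow i t) = picard k i s - lin_flow i t); last ring.
rewrite (_ : lin_flow i s - _ + _ = lin_flow i s - lin_flow i t); last ring.
lra.
Qed.

Lemma lin_flow_integral i t : Rabs (t - t0) < r ->
  lin_flow i t = c i + RInt (lin_rhs lin_flow i) t0 t.
Proof.
move=> ht; apply: Rminus_diag_uniq; apply: Rabs_eq_0.
apply: Rle_antisym; last exact: Rabs_pos.
apply: le_epsilon => eps eps0; rewrite Rplus_0_l.
have [k hk] := half_pow_small M eps0.
have h1 := picard_flow_dist k.+1 i ht.
have h2 := @picard_contraction (picard k) lin_flow i t (M * (/ 2) ^ k)
  (fun j s => @picard_continuous k j s) (fun j s => @lin_flow_continuous j s) _ ht.
have {}h2 := h2 (fun j s hs => ltac:(rewrite Rabs_minus_sym; exact: picard_flow_dist)).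
have := Rabs_triang (lin_flow i t - picard k.+1 i t)
   (RInt (lin_rhs (picard k) i) t0 t - RInt (lin_rhs lin_flow i) t0 t).
rewrite (_ : _ + _ = lin_flow i t - (c i + RInt (lin_rhs lin_flow i) t0 t)); last by rewrite /=; ring.
move: h1 h2; rewrite /=; lra.
Qed.

Lemma lin_flow_derive i t : Rabs (t - t0) < r ->
  is_derive (lin_flow i) t (\rsum_(j < n) (a i j t * lin_flow j t)).
Proof.
move=> ht.
apply: (is_derive_ext_loc (fun s => c i + RInt (lin_rhs lin_flow i) t0 s)).
  by apply: filter_imp (ball_interval_locally ht) => s hs; rewrite -lin_flow_integral.
by apply: lin_rhs_RInt_derive => // j s; exact: lin_flow_continuous.
Qed.

Lemma lin_flow_init i : lin_flow i t0 = c i.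
Proof.
rewrite lin_flow_integral; last exact: center_in_ball.
by rewrite (RInt_point (V := R_CompleteNormedModule)) /zero /= Rplus_0_r.
Qed.

End Picard.

(** The derivative of [<x, y>] along two solutions of [z' = B z] vanishes. *)
Lemma skew_pairing n (B : 'I_n -> 'I_n -> R) (x y : 'I_n -> R) :
  (forall a b, B a b = - B b a) ->
  \rsum_(a < n) ((\rsum_(b < n) (B a b * x b)) * y a)
  + \rsum_(a < n) (x a * \rsum_(b < n) (B a b * y b)) = 0.
Proof.
move=> skewB.
rewrite (eq_Rsum (G := fun a => \rsum_(b < n) (y a * (B a b * x b)))); last first.
  by move=> a; rewrite Rmult_comm Rsum_mull.
rewrite Rsum_exchange Rsum_add; apply: Rsum_zero => a.
rewrite Rsum_mull Rsum_add; apply: Rsum_zero => b; rewrite (skewB a b); ring.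
Qed.

(** Length estimate: if [x' = B x + rem] with [B] skew, then [|x|^2] has derivative
    [2 <x, rem>], and [|x|] grows at most like the integral of [|rem|].  The square root
    is regularized by [delta] to stay differentiable where [x] vanishes. *)
Lemma skew_energy_estimate n (B : 'I_n -> 'I_n -> R -> R) (x rem : 'I_n -> R -> R)
    t0 t1 eps i :
  (forall a b s, Rmin t0 t1 <= s <= Rmax t0 t1 -> B a b s = - B b a s) ->
  (forall a s, Rmin t0 t1 <= s <= Rmax t0 t1 ->
     is_derive (x a) s (\rsum_(b < n) (B a b s * x b s) + rem a s)) ->
  (forall a s, Rmin t0 t1 <= s <= Rmax t0 t1 -> Rabs (rem a s) <= eps) ->
  Rabs (x i t1) <= \rsum_(j < n) Rabs (x j t0) + INR n * eps * Rabs (t1 - t0).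
Proof.
move=> skewB xd rem_le; apply: le_epsilon => delta delta0.
pose S s := \rsum_(a < n) (x a s * x a s) + delta ^ 2.
have S_pos s : 0 < S s.
  have := Rsum_ge0 (fun a => Rle_0_sqr (x a s)); have := pow_lt delta 2 delta0.
  by rewrite /S /Rsqr; lra.
have x_le a s : Rabs (x a s) <= sqrt (S s).
  rewrite -sqrt_Rsqr_abs; apply: sqrt_le_1_alt.
  have := @Rsum_ge_term n (fun a => x a s * x a s) a (fun a => Rle_0_sqr (x a s)).
  by have := pow_lt delta 2 delta0; rewrite /S /Rsqr; lra.
have S_deriv s : Rmin t0 t1 <= s <= Rmax t0 t1 ->
    is_derive S s (2 * \rsum_(a < n) (x a s * rem a s)).
  move=> hs; rewrite -[X in is_derive _ _ X]Rplus_0_r.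
  apply: (@is_derive_plus _ R_NormedModule); last exact: is_derive_const.
  have -> : 2 * \rsum_(a < n) (x a s * rem a s)
     = \rsum_(a < n) ((\rsum_(b < n) (B a b s * x b s) + rem a s) * x a s
                      + x a s * (\rsum_(b < n) (B a b s * x b s) + rem a s)).
    have := @skew_pairing n (fun a b => B a b s) (fun a => x a s) (fun a => x a s)
                          (fun a b => skewB a b s hs).
    rewrite Rsum_add Rsum_mull => skew0.
    rewrite -[LHS]Rplus_0_l -skew0 Rsum_add; apply: eq_Rsum => a; ring.
  by apply: is_derive_Rsum => a; apply: (is_derive_mult (x a) (x a)); try exact: xd; exact: Rmult_comm.
have sqrt_deriv s : Rmin t0 t1 <= s <= Rmax t0 t1 ->
    is_derive (fun s => sqrt (S s)) s
      ((2 * \rsum_(a < n) (x a s * rem a s)) / (2 * sqrt (S s))).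
  by move=> hs; apply: is_derive_sqrt; [exact: S_deriv | exact: S_pos].
have bound s : Rmin t0 t1 <= s <= Rmax t0 t1 ->
    Rabs ((2 * \rsum_(a < n) (x a s * rem a s)) / (2 * sqrt (S s))) <= INR n * eps.
  move=> hs; have sp := sqrt_lt_R0 _ (S_pos s).
  have -> : (2 * \rsum_(a < n) (x a s * rem a s)) / (2 * sqrt (S s))
      = \rsum_(a < n) (/ sqrt (S s) * (x a s * rem a s)).
    by rewrite -Rsum_mull; field; lra.
  apply: Rle_trans (Rabs_sum _) _; apply: Rsum_le_const => a.
  rewrite !Rabs_mult Rabs_inv (Rabs_pos_eq (sqrt _)); last lra.
  rewrite -[X in _ <= X]Rmult_1_l -Rmult_assoc.
  apply: Rmult_le_compat; try exact: Rabs_pos; last exact: rem_le.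
    by apply: Rmult_le_pos (Rabs_pos _); left; exact: Rinv_0_lt_compat.
  rewrite -(Rinv_l (sqrt (S s))); last lra.
  by apply: Rmult_le_compat_l (x_le a s); left; exact: Rinv_0_lt_compat.
have := lipschitz_of_derive sqrt_deriv bound.
have S0 : sqrt (S t0) <= \rsum_(j < n) Rabs (x j t0) + delta.
  have abs0 := Rsum_ge0 (fun j => Rabs_pos (x j t0)).
  rewrite -(sqrt_pow2 (_ + delta)); last lra.
  apply: sqrt_le_1_alt; have := Rsum_sqr_le (fun j => x j t0); rewrite /S.
  have := Rmult_le_pos _ _ abs0 (Rlt_le _ _ delta0); rewrite /=; nra.
have := x_le i t1; have := Rle_abs (sqrt (S t1) - sqrt (S t0)); lra.
Qed.

(** * Functions of two variables *)

Lemma open_locally_2d (D : R * R -> Prop) u v :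
  open D -> D (u, v) -> locally_2d (fun x y => D (x, y)) u v.
Proof.
move=> oD Duv; apply/locally_2d_locally.
by apply: filter_imp (oD _ Duv) => - [x y].
Qed.

Lemma open_locally_u (D : R * R -> Prop) u v :
  open D -> D (u, v) -> locally u (fun t => D (t, v)).
Proof.
move=> oD Duv; have [d hd] := open_locally_2d oD Duv.
by exists d => t ht; apply: hd => //; rewrite Rminus_diag Rabs_R0; exact: cond_pos.
Qed.

Lemma open_locally_v (D : R * R -> Prop) u v :
  open D -> D (u, v) -> locally v (fun t => D (u, t)).
Proof.
move=> oD Duv; have [d hd] := open_locally_2d oD Duv.
by exists d => t ht; apply: hd => //; rewrite Rminus_diag Rabs_R0; exact: cond_pos.
Qed.

Section SmoothCalculus.

Variable D : R * R -> Prop.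
Hypothesis oD : open D.

Definition diff_on (n : nat) (f : R -> R -> R) : Prop :=
  forall u v, D (u, v) -> ex_diff_n f n u v.

Lemma smooth_diff_on f : smooth_on D f <-> forall n, diff_on n f.
Proof. by split=> h n u v; exact: h. Qed.

Lemma diff_on_pred n f : diff_on n.+1 f -> diff_on n f.
Proof. by move=> fd u v Duv; apply: ex_diff_n_m (fd u v Duv); apply/leP. Qed.

Lemma diff_on_Du n f : diff_on n.+1 f -> diff_on n (Du f).
Proof. by move=> fd u v Duv; case: (fd u v Duv) => _ [_ [_ []]]. Qed.

Lemma diff_on_Dv n f : diff_on n.+1 f -> diff_on n (Dv f).
Proof. by move=> fd u v Duv; case: (fd u v Duv) => _ [_ [_ []]]. Qed.

Lemma diff_on_S n f :
  diff_on 0 f ->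
  (forall u v, D (u, v) -> ex_derive (fun t => f t v) u /\ ex_derive (fun t => f u t) v) ->
  diff_on n (Du f) -> diff_on n (Dv f) -> diff_on n.+1 f.
Proof.
move=> f0 fe fu fv u v Duv; have [eu ev] := fe u v Duv.
by split; [case: (f0 u v Duv) | split; [|split; [|split; [exact: fu | exact: fv]]]].
Qed.

Lemma diff_on_ext n f g :
  (forall u v, D (u, v) -> f u v = g u v) -> diff_on n f -> diff_on n g.
Proof.
move=> fg fd u v Duv; apply: ex_diff_n_ext_loc (fd u v Duv).
by have [d hd] := open_locally_2d oD Duv; exists d => x y hx hy; apply: fg; exact: hd.
Qed.

Lemma Du_ext f g u v :
  (forall u v, D (u, v) -> f u v = g u v) -> D (u, v) -> Du f u v = Du g u v.
Proof.
move=> fg Duv; apply: Derive_ext_loc.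
by apply: filter_imp (open_locally_u oD Duv) => t; exact: fg.
Qed.

Lemma Dv_ext f g u v :
  (forall u v, D (u, v) -> f u v = g u v) -> D (u, v) -> Dv f u v = Dv g u v.
Proof.
move=> fg Duv; apply: Derive_ext_loc.
by apply: filter_imp (open_locally_v oD Duv) => t; exact: fg.
Qed.

Lemma diff_on_derive n f u v : diff_on n.+1 f -> D (u, v) ->
  is_derive (fun t => f t v) u (Du f u v) /\ is_derive (fun t => f u t) v (Dv f u v).
Proof.
by move=> fd Duv; case: (fd u v Duv) => _ [eu [ev _]]; split; apply: Derive_correct.
Qed.

Lemma smooth_derive_u f u v : smooth_on D f -> D (u, v) ->
  is_derive (fun t => f t v) u (Du f u v).
Proof. by move=> /smooth_diff_on /(_ 1%nat) fd /(diff_on_derive fd) []. Qed.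

Lemma smooth_derive_v f u v : smooth_on D f -> D (u, v) ->
  is_derive (fun t => f u t) v (Dv f u v).
Proof. by move=> /smooth_diff_on /(_ 1%nat) fd /(diff_on_derive fd) []. Qed.

Lemma smooth_continuity f u v : smooth_on D f -> D (u, v) -> continuity_2d_pt f u v.
Proof. by move=> fs Duv; case: (fs 0%nat u v Duv). Qed.

Lemma smooth_Du f : smooth_on D f -> smooth_on D (Du f).
Proof. by move=> fs n; apply: diff_on_Du => u v; exact: fs. Qed.

Lemma smooth_Dv f : smooth_on D f -> smooth_on D (Dv f).
Proof. by move=> fs n; apply: diff_on_Dv => u v; exact: fs. Qed.

Lemma smooth_ext f g :
  (forall u v, D (u, v) -> f u v = g u v) -> smooth_on D f -> smooth_on D g.
Proof. by move=> fg fs n; apply: (diff_on_ext fg) => u v; exact: fs. Qed.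

Lemma smooth_symm f u v : smooth_on D f -> D (u, v) -> Du (Dv f) u v = Dv (Du f) u v.
Proof.
move=> fs Duv; apply: Schwarz.
- have [d hd] := open_locally_2d oD Duv; exists d => x y hx hy.
  have Dxy := hd x y hx hy.
  by split; [|split; [|split]]; eexists;
     [exact: smooth_derive_u | exact: smooth_derive_v
     |exact: (smooth_derive_u (smooth_Dv fs)) | exact: (smooth_derive_v (smooth_Du fs))].
- exact: (smooth_continuity (smooth_Du (smooth_Dv fs))).
- exact: (smooth_continuity (smooth_Dv (smooth_Du fs))).
Qed.

Lemma diff_on_const n c : diff_on n (fun _ _ => c).
Proof.
elim: n c => [|n IHn] c; first by split=> //; exact: continuity_2d_pt_const.
apply: diff_on_S.
- by split=> //; exact: continuity_2d_pt_const.
- by split; eexists; exact: is_derive_const.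
- by apply: diff_on_ext (IHn 0) => u v _; rewrite /Du Derive_const.
- by apply: diff_on_ext (IHn 0) => u v _; rewrite /Dv Derive_const.
Qed.

Lemma diff_on_plus n f g :
  diff_on n f -> diff_on n g -> diff_on n (fun u v => f u v + g u v).
Proof.
elim: n f g => [|n IHn] f g fd gd.
  move=> u v Duv; split=> //; apply: continuity_2d_pt_plus.
    by case: (fd u v Duv).
  by case: (gd u v Duv).
apply: diff_on_S => [u v Duv|u v Duv||].
- split=> //; apply: continuity_2d_pt_plus.
    by case: (fd u v Duv).
  by case: (gd u v Duv).
- have [fu fv] := diff_on_derive fd Duv; have [gu gv] := diff_on_derive gd Duv.
  by split; eexists; apply: (@is_derive_plus _ R_NormedModule); eassumption.
- apply: diff_on_ext (IHn _ _ (diff_on_Du fd) (diff_on_Du gd)) => u v Duv.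
  have [fu _] := diff_on_derive fd Duv; have [gu _] := diff_on_derive gd Duv.
  by rewrite /Du Derive_plus; [|eexists; exact: fu|eexists; exact: gu].
- apply: diff_on_ext (IHn _ _ (diff_on_Dv fd) (diff_on_Dv gd)) => u v Duv.
  have [_ fv] := diff_on_derive fd Duv; have [_ gv] := diff_on_derive gd Duv.
  by rewrite /Dv Derive_plus; [|eexists; exact: fv|eexists; exact: gv].
Qed.

Lemma diff_on_mult n f g :
  diff_on n f -> diff_on n g -> diff_on n (fun u v => f u v * g u v).
Proof.
elim: n f g => [|n IHn] f g fd gd.
  move=> u v Duv; split=> //; apply: continuity_2d_pt_mult.
    by case: (fd u v Duv).
  by case: (gd u v Duv).
have [f' g'] := (diff_on_pred fd, diff_on_pred gd).
apply: diff_on_S => [u v Duv|u v Duv||].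
- split=> //; apply: continuity_2d_pt_mult.
    by case: (fd u v Duv).
  by case: (gd u v Duv).
- have [fu fv] := diff_on_derive fd Duv; have [gu gv] := diff_on_derive gd Duv.
  by split; apply: ex_derive_mult; eexists; eassumption.
- apply: diff_on_ext (diff_on_plus (IHn _ _ (diff_on_Du fd) g') (IHn _ _ f' (diff_on_Du gd))) => u v Duv.
  have [fu _] := diff_on_derive fd Duv; have [gu _] := diff_on_derive gd Duv.
  by rewrite /Du Derive_mult; [|eexists; exact: fu|eexists; exact: gu].
- apply: diff_on_ext (diff_on_plus (IHn _ _ (diff_on_Dv fd) g') (IHn _ _ f' (diff_on_Dv gd))) => u v Duv.
  have [_ fv] := diff_on_derive fd Duv; have [_ gv] := diff_on_derive gd Duv.
  by rewrite /Dv Derive_mult; [|eexists; exact: fv|eexists; exact: gv].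
Qed.

Lemma diff_on_inv n f : (forall u v, D (u, v) -> f u v <> 0) ->
  diff_on n f -> diff_on n (fun u v => / f u v).
Proof.
move=> f0; elim: n => [|n IHn] fd.
  move=> u v Duv; split=> //; apply: continuity_2d_pt_inv; last exact: f0.
  by case: (fd u v Duv).
have i' := IHn (diff_on_pred fd).
have i2 := diff_on_mult (diff_on_const n (-1)) (diff_on_mult i' i').
apply: diff_on_S => [u v Duv|u v Duv||].
- split=> //; apply: continuity_2d_pt_inv; last exact: f0.
  by case: (fd u v Duv).
- have [fu fv] := diff_on_derive fd Duv.
  by split; apply: ex_derive_inv; try exact: f0; eexists; eassumption.
- apply: diff_on_ext (diff_on_mult (diff_on_Du fd) i2) => u v Duv.
  have [fu _] := diff_on_derive fd Duv; have := f0 _ _ Duv => fne.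
  by rewrite [RHS]Derive_inv //; [rewrite -/(Du f u v); field | eexists; exact: fu].
- apply: diff_on_ext (diff_on_mult (diff_on_Dv fd) i2) => u v Duv.
  have [_ fv] := diff_on_derive fd Duv; have := f0 _ _ Duv => fne.
  by rewrite [RHS]Derive_inv //; [rewrite -/(Dv f u v); field | eexists; exact: fv].
Qed.

Lemma smooth_const c : smooth_on D (fun _ _ => c).
Proof. by move=> n; exact: diff_on_const. Qed.

Lemma smooth_plus f g :
  smooth_on D f -> smooth_on D g -> smooth_on D (fun u v => f u v + g u v).
Proof. by move=> fs gs n; apply: diff_on_plus => u v; [exact: fs | exact: gs]. Qed.

Lemma smooth_mult f g :
  smooth_on D f -> smooth_on D g -> smooth_on D (fun u v => f u v * g u v).
Proof. by move=> fs gs n; apply: diff_on_mult => u v; [exact: fs | exact: gs]. Qed.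

Lemma smooth_opp f : smooth_on D f -> smooth_on D (fun u v => - f u v).
Proof.
move=> fs; apply: smooth_ext (smooth_mult (smooth_const (-1)) fs) => u v _; ring.
Qed.

Lemma smooth_inv f : (forall u v, D (u, v) -> f u v <> 0) ->
  smooth_on D f -> smooth_on D (fun u v => / f u v).
Proof. by move=> f0 fs n; apply: diff_on_inv => // u v; exact: fs. Qed.

Lemma diff_on_Rsum n m (F : 'I_m -> R -> R -> R) :
  (forall i, diff_on n (F i)) -> diff_on n (fun u v => \rsum_(i < m) F i u v).
Proof.
move=> Fd.
suff : diff_on n ((fun r u v => \sum_(i <- r) F i u v) (index_enum 'I_m)) by [].
elim: (index_enum _) => [|i r IHr].
  by apply: diff_on_ext (diff_on_const n 0) => u v _; rewrite big_nil.
by apply: diff_on_ext (diff_on_plus (Fd i) IHr) => u v _; rewrite big_cons.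
Qed.

(** Derivatives of a solution are linear combinations of the solution itself, so
    each order of differentiability gives the next one. *)
Lemma smooth_of_linear_system m (A B : 'I_m -> 'I_m -> R -> R -> R)
    (z : 'I_m -> R -> R -> R) :
  (forall a b, smooth_on D (A a b)) -> (forall a b, smooth_on D (B a b)) ->
  (forall a u v, D (u, v) -> continuity_2d_pt (z a) u v) ->
  (forall a u v, D (u, v) ->
     is_derive (fun t => z a t v) u (\rsum_(b < m) (A a b u v * z b u v))) ->
  (forall a u v, D (u, v) ->
     is_derive (fun t => z a u t) v (\rsum_(b < m) (B a b u v * z b u v))) ->
  forall a, smooth_on D (z a).
Proof.
move=> As Bs zc zu zv a n; move: n a.
elim=> [|n IHn] a; first by move=> u v Duv; split=> //; exact: zc.
apply: diff_on_S => [u v Duv|u v Duv||].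
- by split=> //; exact: zc.
- by split; eexists; [exact: zu | exact: zv].
- apply: (@diff_on_ext _ (fun u v => \rsum_(b < m) (A a b u v * z b u v))).
    by move=> u v Duv; symmetry; apply: is_derive_unique; exact: zu.
  by apply: diff_on_Rsum => b; apply: diff_on_mult; [exact: As | exact: IHn].
- apply: (@diff_on_ext _ (fun u v => \rsum_(b < m) (B a b u v * z b u v))).
    by move=> u v Duv; symmetry; apply: is_derive_unique; exact: zv.
  by apply: diff_on_Rsum => b; apply: diff_on_mult; [exact: Bs | exact: IHn].
Qed.

End SmoothCalculus.

(** * Integrable skew linear systems in two variables *)

(** A property that survives shrinking of the radius has a radius common to finitely many
    instances. *)
Lemma uniform_radius (T : finType) (P : T -> R -> Prop) :
  (forall i d d', 0 < d' <= d -> P i d -> P i d') ->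
  (forall i, exists d, 0 < d /\ P i d) ->
  exists d, 0 < d /\ forall i, P i d.
Proof.
move=> Pmono Pex.
suff [d [d0 hd]] : exists d, 0 < d /\ forall i, i \in enum T -> P i d.
  by exists d; split=> // i; apply: hd; rewrite mem_enum.
elim: (enum T) => [|i s [d [d0 hd]]]; first by exists 1; split; [lra | ].
have [e [e0 he]] := Pex i; have m0 := Rmin_pos _ _ d0 e0.
exists (Rmin d e); split=> // j; rewrite in_cons => /orP[/eqP -> |js].
  by apply: Pmono he; split=> //; exact: Rmin_r.
by apply: Pmono (hd j js); split=> //; exact: Rmin_l.
Qed.

Lemma is_derive_littleo (f : R -> R) x l :
  is_derive f x l <->
  forall eps, 0 < eps -> exists d, 0 < d /\ forall h, Rabs h < d ->
    Rabs (f (x + h) - f x - h * l) <= eps * Rabs h.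
Proof.
rewrite is_derive_Reals; split=> fd eps eps0.
  have [d hd] := fd eps eps0; exists d; split; first exact: cond_pos.
  move=> h hh; have [->|h0] := Req_dec h 0.
    by rewrite Rplus_0_r Rminus_diag Rmult_0_l Rminus_0_r Rabs_R0 Rmult_0_r; exact: Rle_refl.
  have := hd h h0 hh => /Rlt_le /(Rmult_le_compat_r (Rabs h) _ _ (Rabs_pos h)).
  by rewrite -Rabs_mult (_ : _ * h = f (x + h) - f x - h * l) //; field.
have [d [d0 hd]] := fd (eps / 2) ltac:(lra); exists (mkposreal d d0) => h h0 /= hh.
have hp := Rabs_pos_lt _ h0.
rewrite (_ : _ - l = (f (x + h) - f x - h * l) / h); last by field.
rewrite Rabs_mult Rabs_inv.
apply: Rle_lt_trans (Rmult_le_compat_r _ _ _ _ (hd h hh)) _.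
  by left; exact: Rinv_0_lt_compat.
rewrite Rmult_assoc Rinv_r; lra.
Qed.

Lemma taylor1_bound (f f1 f2 : R -> R) a b K :
  (forall t, Rmin a b <= t <= Rmax a b -> is_derive f t (f1 t)) ->
  (forall t, Rmin a b <= t <= Rmax a b -> is_derive f1 t (f2 t)) ->
  (forall t, Rmin a b <= t <= Rmax a b -> Rabs (f2 t) <= K) ->
  Rabs (f b - f a - (b - a) * f1 a) <= K * (b - a) ^ 2.
Proof.
move=> fd f1d f2K.
have a_in : Rmin a b <= a <= Rmax a b by split; [exact: Rmin_l | exact: Rmax_l].
have K0 : 0 <= K := Rle_trans _ _ _ (Rabs_pos _) (f2K a a_in).
have gd t : Rmin a b <= t <= Rmax a b ->
    is_derive (fun s => f s - s * f1 a) t (f1 t - 1 * f1 a).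
  move=> ht; apply: (@is_derive_minus _ R_NormedModule); first exact: fd.
  by apply: is_derive_scal_l; exact: is_derive_id.
have gK t : Rmin a b <= t <= Rmax a b -> Rabs (f1 t - 1 * f1 a) <= K * Rabs (b - a).
  move=> ht; rewrite Rmult_1_l.
  have sub s : Rmin a t <= s <= Rmax a t -> Rmin a b <= s <= Rmax a b.
    move: ht; rewrite /Rmin /Rmax; case: Rle_dec => h1; case: Rle_dec => h2; lra.
  apply: (Rle_trans _ (K * Rabs (t - a))).
    by apply: (@lipschitz_of_derive f1 f2) => s /sub; [exact: f1d | exact: f2K].
  apply: Rmult_le_compat_l => //.
  move: ht; rewrite /Rmin /Rmax; case: Rle_dec => h1 ht.
    by rewrite !Rabs_pos_eq; lra.
  by rewrite !Rabs_left1; lra.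
have := lipschitz_of_derive gd gK.
rewrite (_ : _ - (f a - _) = f b - f a - (b - a) * f1 a); last ring.
by rewrite Rmult_assoc -Rabs_mult -Rsqr_pow2 (Rabs_pos_eq ((b - a) * (b - a))) //; exact: Rle_0_sqr.
Qed.

Definition square (u0 v0 r : R) : R * R -> Prop :=
  fun p => Rabs (p.1 - u0) < r /\ Rabs (p.2 - v0) < r.

Lemma square_open u0 v0 r : open (square u0 v0 r).
Proof.
move=> [u v] [/= hu hv]; apply/(locally_2d_locally (fun u v => square u0 v0 r (u, v))).
apply/locally_2d_and.
  have d0 : 0 < r - Rabs (u - u0) by lra.
  exists (mkposreal _ d0) => x y /= hx _.
  by have := Rabs_triang (x - u) (u - u0); rewrite (_ : x - u + (u - u0) = x - u0); [lra | ring].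
have d0 : 0 < r - Rabs (v - v0) by lra.
exists (mkposreal _ d0) => x y /= _ hy.
by have := Rabs_triang (y - v) (v - v0); rewrite (_ : y - v + (v - v0) = y - v0); [lra | ring].
Qed.

Lemma square_center u0 v0 r : 0 < r -> square u0 v0 r (u0, v0).
Proof. by move=> r0; rewrite /square /= !Rminus_diag Rabs_R0. Qed.

(** All constants are uniform on the square [S]: [K] bounds the coefficients together with
    the two derivatives of [B] that Taylor's formula in [u] uses. *)
Section IntegrableSystem.

Variables (n : nat) (A B : 'I_n -> 'I_n -> R -> R -> R) (u0 v0 r K : R).
Let S := square u0 v0 r.
Hypothesis r_gt0 : 0 < r.
Hypothesis A_smooth : forall a b, smooth_on S (A a b).
Hypothesis B_smooth : forall a b, smooth_on S (B a b).
Hypothesis A_skew : forall a b u v, S (u, v) -> A a b u v = - A b a u v.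
Hypothesis B_skew : forall a b u v, S (u, v) -> B a b u v = - B b a u v.
Hypothesis flat : forall a b u v, S (u, v) ->
  Dv (A a b) u v + \rsum_(c < n) (A a c u v * B c b u v)
  = Du (B a b) u v + \rsum_(c < n) (B a c u v * A c b u v).
Hypothesis A_le : forall a b u v, S (u, v) -> Rabs (A a b u v) <= K.
Hypothesis B_le : forall a b u v, S (u, v) -> Rabs (B a b u v) <= K.
Hypothesis Bu_le : forall a b u v, S (u, v) -> Rabs (Du (B a b) u v) <= K.
Hypothesis Buu_le : forall a b u v, S (u, v) -> Rabs (Du (Du (B a b)) u v) <= K.
Hypothesis small : INR n * K * r <= / 2.

Variable c : 'I_n -> R.

(** The initial values along the line [v = v0]. *)
Definition axis_flow (a : 'I_n) (u : R) : R :=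
  lin_flow (fun a b t => A a b t v0) u0 c a u.

Definition flow (a : 'I_n) (u v : R) : R :=
  lin_flow (fun a b t => B a b u t) v0 (fun b => axis_flow b u) a v.

Let v0_in : Rabs (v0 - v0) < r. Proof. exact: center_in_ball. Qed.
Let u0_in : Rabs (u0 - u0) < r. Proof. exact: center_in_ball. Qed.

Lemma axis_flow_derive a u : Rabs (u - u0) < r ->
  is_derive (axis_flow a) u (\rsum_(b < n) (A a b u v0 * axis_flow b u)).
Proof.
move=> hu; apply: (@lin_flow_derive n (fun a b t => A a b t v0) u0 c r K) => //.
- move=> i j t ht; apply: (ex_derive_continuous (V := R_NormedModule)).
  by eexists; exact: (smooth_derive_u (A_smooth i j)).
- by move=> i j t ht; exact: A_le.
Qed.

Lemma flow_derive_v a u v : S (u, v) ->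
  is_derive (fun t => flow a u t) v (\rsum_(b < n) (B a b u v * flow b u v)).
Proof.
move=> [/= hu hv].
apply: (@lin_flow_derive n (fun a b t => B a b u t) v0 (fun b => axis_flow b u) r K) => //.
- move=> i j t ht; apply: (ex_derive_continuous (V := R_NormedModule)).
  by eexists; exact: (smooth_derive_v (B_smooth i j)).
- by move=> i j t ht; exact: B_le.
Qed.

Lemma flow_axis a u : Rabs (u - u0) < r -> flow a u v0 = axis_flow a u.
Proof.
move=> hu; rewrite /flow.
apply: (@lin_flow_init n (fun a b t => B a b u t) v0 (fun b => axis_flow b u) r K) => //.
- move=> i j t ht; apply: (ex_derive_continuous (V := R_NormedModule)).
  by eexists; exact: (smooth_derive_v (B_smooth i j)).
- by move=> i j t ht; exact: B_le.
Qed.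

Lemma axis_flow_init a : axis_flow a u0 = c a.
Proof.
rewrite /axis_flow.
apply: (@lin_flow_init n (fun a b t => A a b t v0) u0 c r K) => //.
- move=> i j t ht; apply: (ex_derive_continuous (V := R_NormedModule)).
  by eexists; exact: (smooth_derive_u (A_smooth i j)).
- by move=> i j t ht; exact: A_le.
Qed.

Let M := INR n * \rsum_(j < n) Rabs (c j).

Lemma flow_bound a u v : S (u, v) -> Rabs (flow a u v) <= M.
Proof.
move=> [/= hu hv].
have v_in t : Rmin v0 v <= t <= Rmax v0 v -> S (u, t).
  by move=> ht; split=> //; exact: between_dist v0_in hv ht.
have u_in t : Rmin u0 u <= t <= Rmax u0 u -> S (t, v0).
  by move=> ht; split=> //; exact: between_dist u0_in hu ht.
have axis_le b : Rabs (axis_flow b u) <= \rsum_(j < n) Rabs (c j).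
  have := @skew_energy_estimate n (fun a b t => A a b t v0) axis_flow (fun _ _ => 0) u0 u 0 b.
  rewrite Rmult_0_r Rmult_0_l Rplus_0_r (eq_Rsum (fun j => f_equal Rabs (axis_flow_init j))).
  apply=> [i j s hs|i s hs|i s _]; last by rewrite Rabs_R0; exact: Rle_refl.
    by apply: A_skew; exact: u_in.
  by rewrite Rplus_0_r; apply: axis_flow_derive; case: (u_in s hs).
have := @skew_energy_estimate n (fun a b t => B a b u t) (fun a t => flow a u t)
          (fun _ _ => 0) v0 v 0 a.
rewrite Rmult_0_r Rmult_0_l Rplus_0_r => h; apply: Rle_trans (h _ _ _) _.
- by move=> i j s hs; apply: B_skew; exact: v_in.
- by move=> i s hs; rewrite Rplus_0_r; apply: flow_derive_v; exact: v_in.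
- by move=> i s _; rewrite Rabs_R0; exact: Rle_refl.
by apply: Rsum_le_const => j; rewrite flow_axis.
Qed.

Definition A_flow (a : 'I_n) (u v : R) : R := \rsum_(b < n) (A a b u v * flow b u v).

Lemma A_flow_bound a u v : S (u, v) -> Rabs (A_flow a u v) <= INR n * (K * M).
Proof. by move=> h; apply: Rabs_lin_le => b; [exact: A_le | exact: flow_bound]. Qed.

(** By flatness, [A_flow] solves the equation obtained by differentiating
    [flow_v = B flow] with respect to [u]: it is the only candidate for [flow_u]. *)
Lemma A_flow_derive_v a u v : S (u, v) ->
  is_derive (fun t => A_flow a u t) v
    (\rsum_(b < n) (B a b u v * A_flow b u v) + \rsum_(b < n) (Du (B a b) u v * flow b u v)).
Proof.
move=> Suv.
have -> : \rsum_(b < n) (B a b u v * A_flow b u v)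
     + \rsum_(b < n) (Du (B a b) u v * flow b u v)
   = \rsum_(b < n) (Dv (A a b) u v * flow b u v
        + A a b u v * \rsum_(d < n) (B b d u v * flow d u v)).
  rewrite -Rsum_add !Rsum_assoc !Rsum_add; apply: eq_Rsum => b.
  have := flat a b Suv; set X := \rsum_(_ < n) _; set Y := \rsum_(_ < n) _ => h.
  by rewrite -!Rmult_plus_distr_r h; ring.
apply: is_derive_Rsum => b; apply: (is_derive_mult (A a b u) (flow b u)).
- exact: smooth_derive_v.
- exact: flow_derive_v.
- exact: Rmult_comm.
Qed.

Let C := INR n * (K * M) + INR n * (K * (INR n * (K * M))).

(** The increment of [flow] in [u] differs from its candidate linear part by a
    solution of a skew system with a source of order [h ^ 2], and with initial
    value [o(h)]. *)
Lemma flow_increment a u v h : S (u, v) -> Rabs (u + h - u0) < r ->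
  Rabs (flow a (u + h) v - flow a u v - h * A_flow a u v)
  <= \rsum_(b < n) Rabs (axis_flow b (u + h) - axis_flow b u
                         - h * \rsum_(d < n) (A b d u v0 * axis_flow d u))
     + INR n * (C * h ^ 2) * r.
Proof.
move=> [/= hu hv] huh.
have v_in t : Rmin v0 v <= t <= Rmax v0 v -> Rabs (t - v0) < r.
  exact: between_dist v0_in hv.
have u_in t s : Rmin u (u + h) <= s <= Rmax u (u + h) -> Rabs (t - v0) < r -> S (s, t).
  by move=> hs ht; split=> //; exact: between_dist hu huh hs.
pose x a t := flow a (u + h) t - flow a u t - h * A_flow a u t.
pose rem a t :=
  \rsum_(b < n) ((B a b (u + h) t - B a b u t - h * Du (B a b) u t) * flow b u t)
  + h * \rsum_(b < n) ((B a b (u + h) t - B a b u t) * A_flow b u t).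
have x_deriv i t : Rmin v0 v <= t <= Rmax v0 v ->
    is_derive (x i) t (\rsum_(b < n) (B i b (u + h) t * x b t) + rem i t).
  move=> /v_in ht.
  have -> : \rsum_(b < n) (B i b (u + h) t * x b t) + rem i t
    = \rsum_(b < n) (B i b (u + h) t * flow b (u + h) t)
      - \rsum_(b < n) (B i b u t * flow b u t)
      - h * (\rsum_(b < n) (B i b u t * A_flow b u t)
             + \rsum_(b < n) (Du (B i b) u t * flow b u t)).
    rewrite /rem Rsum_add !Rsum_mull !Rsum_sub !Rsum_add.
    by apply: eq_Rsum => b; rewrite /x; ring.
  apply: (@is_derive_minus _ R_NormedModule).
    apply: (@is_derive_minus _ R_NormedModule); exact: flow_derive_v.
  by apply: (is_derive_scal (A_flow i u)); exact: A_flow_derive_v.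
have rem_le i t : Rmin v0 v <= t <= Rmax v0 v -> Rabs (rem i t) <= C * h ^ 2.
  move=> /v_in ht; have Sut : S (u, t) by [].
  have ta b : Rabs (B i b (u + h) t - B i b u t - h * Du (B i b) u t) <= K * h ^ 2.
    have := @taylor1_bound (fun s => B i b s t) (fun s => Du (B i b) s t)
      (fun s => Du (Du (B i b)) s t) u (u + h) K.
    rewrite (_ : u + h - u = h); last ring.
    apply=> s hs; have Sst := u_in t s hs ht.
    - exact: smooth_derive_u.
    - by apply: (smooth_derive_u (smooth_Du _)).
    - exact: Buu_le.
  have li b : Rabs (B i b (u + h) t - B i b u t) <= K * Rabs h.
    have := @lipschitz_of_derive (fun s => B i b s t) (fun s => Du (B i b) s t) u (u + h) K.
    rewrite (_ : u + h - u = h); last ring.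
    apply=> s hs; have Sst := u_in t s hs ht; last exact: Bu_le.
    exact: smooth_derive_u.
  apply: Rle_trans (Rabs_triang _ _) _; rewrite Rabs_mult.
  have h1 := Rabs_lin_le ta (fun b => flow_bound b Sut).
  have h2 := Rabs_lin_le li (fun b => A_flow_bound b Sut).
  have := Rmult_le_compat_l _ _ _ (Rabs_pos h) h2.
  have h_sq : h ^ 2 = Rabs h * Rabs h by rewrite -Rabs_mult Rabs_pos_eq /=; [ring | exact: Rle_0_sqr].
  rewrite /C; move: h1; rewrite h_sq; lra.
have := @skew_energy_estimate n (fun i b t => B i b (u + h) t) x rem v0 v (C * h ^ 2) a.
rewrite (eq_Rsum (G := fun b => Rabs (axis_flow b (u + h) - axis_flow b u
                         - h * \rsum_(d < n) (A b d u v0 * axis_flow d u)))); last first.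
  move=> b; rewrite /x !flow_axis // /A_flow.
  by rewrite (eq_Rsum (fun d => f_equal (Rmult (A b d u v0)) (flow_axis d hu))).
move=> est; apply: Rle_trans (est _ x_deriv rem_le) _.
  by move=> i b s /v_in hs; exact: B_skew.
apply: Rplus_le_compat_l; apply: Rmult_le_compat_l; last by left.
have C0 : 0 <= C * h ^ 2.
  by apply: Rle_trans (Rabs_pos _) (rem_le a v0 _); split; [exact: Rmin_l | exact: Rmax_l].
by apply: Rmult_le_pos => //; exact: pos_INR.
Qed.

(** By [flow_increment] the error is [o(h)]: the initial values contribute [o(h)] since
    [axis_flow] is differentiable, and the source contributes [O(h ^ 2)]. *)
Lemma flow_derive_u a u v : S (u, v) ->
  is_derive (fun t => flow a t v) u (\rsum_(b < n) (A a b u v * flow b u v)).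
Proof.
move=> Suv; have [/= hu hv] := Suv; apply/is_derive_littleo => eps eps0.
pose N1 := INR n + 1; have N1_gt0 : 0 < N1 by have := pos_INR n; rewrite /N1; lra.
have e0 : 0 < eps / (2 * N1) by apply: Rdiv_lt_0_compat; lra.
(* Half of [eps] is shared among the [n] components of the initial value, the other
   half is left for the source; [N1] and [L] are shifted by one to be positive. *)
pose P (b : 'I_n) d := forall h, Rabs h < d ->
  Rabs (axis_flow b (u + h) - axis_flow b u
        - h * \rsum_(d < n) (A b d u v0 * axis_flow d u)) <= eps / (2 * N1) * Rabs h.
have [d1 [d1_gt0 hd1]] : exists d, 0 < d /\ forall b, P b d.
  apply: uniform_radius => [b d d' dd' Pd h hh|b]; first by apply: Pd; lra.
  have /is_derive_littleo /(_ _ e0) := axis_flow_derive b hu; exact.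
have d2_gt0 : 0 < r - Rabs (u - u0) by lra.
pose L := Rabs (INR n * C * r) + 1.
have L_gt0 : 0 < L by have := Rabs_pos (INR n * C * r); rewrite /L; lra.
have d3_gt0 : 0 < eps / (2 * L) by apply: Rdiv_lt_0_compat; lra.
exists (Rmin d1 (Rmin (r - Rabs (u - u0)) (eps / (2 * L)))); split.
  by apply: Rmin_pos => //; exact: Rmin_pos.
move=> h hh.
have h1 : Rabs h < d1 by apply: Rlt_le_trans hh (Rmin_l _ _).
have h2 : Rabs h < r - Rabs (u - u0).
  by apply: Rlt_le_trans hh _; apply: Rle_trans (Rmin_r _ _) (Rmin_l _ _).
have h3 : Rabs h < eps / (2 * L).
  by apply: Rlt_le_trans hh _; apply: Rle_trans (Rmin_r _ _) (Rmin_r _ _).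
have huh : Rabs (u + h - u0) < r.
  by have := Rabs_triang h (u - u0); rewrite (_ : h + (u - u0) = u + h - u0); [lra | ring].
apply: Rle_trans (flow_increment a Suv huh) _.
have i1 := Rsum_le_const (fun b => hd1 b h h1).
have i2 : INR n * (eps / (2 * N1) * Rabs h) <= eps / 2 * Rabs h.
  rewrite -Rmult_assoc; apply: Rmult_le_compat_r; first exact: Rabs_pos.
  rewrite (_ : eps / 2 = N1 * (eps / (2 * N1))); last by field; lra.
  by apply: Rmult_le_compat_r; [left | rewrite /N1; lra].
have i3 : INR n * (C * h ^ 2) * r <= eps / 2 * Rabs h.
  have h_sq : h ^ 2 = Rabs h * Rabs h by rewrite -Rabs_mult Rabs_pos_eq /=; [ring | exact: Rle_0_sqr].
  rewrite (_ : _ * r = INR n * C * r * Rabs h * Rabs h); last by rewrite h_sq; ring.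
  apply: Rmult_le_compat_r; first exact: Rabs_pos.
  apply: (Rle_trans _ (L * Rabs h)).
    apply: Rmult_le_compat_r; first exact: Rabs_pos.
    by have := Rle_abs (INR n * C * r); rewrite /L; lra.
  rewrite (_ : eps / 2 = L * (eps / (2 * L))); last by field; lra.
  by apply: Rmult_le_compat_l; lra.
lra.
Qed.

Lemma flow_continuity a u v : S (u, v) -> continuity_2d_pt (flow a) u v.
Proof.
move=> Suv eps; have [/= hu hv] := Suv.
pose L := Rabs (INR n * (K * M)) + 1.
have L_gt0 : 0 < L by have := Rabs_pos (INR n * (K * M)); rewrite /L; lra.
have L_ge : INR n * (K * M) <= L by have := Rle_abs (INR n * (K * M)); rewrite /L; lra.
have [d hd] := open_locally_2d (@square_open u0 v0 r) Suv.
have e_gt0 : 0 < Rmin d (eps / (2 * L)).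
  apply: Rmin_pos; first exact: cond_pos.
  by apply: Rdiv_lt_0_compat; [exact: cond_pos | lra].
exists (mkposreal _ e_gt0) => x y /= hx hy.
have [hx1 hx2] : Rabs (x - u) < d /\ Rabs (x - u) < eps / (2 * L).
  by split; apply: Rlt_le_trans hx _; [exact: Rmin_l | exact: Rmin_r].
have [hy1 hy2] : Rabs (y - v) < d /\ Rabs (y - v) < eps / (2 * L).
  by split; apply: Rlt_le_trans hy _; [exact: Rmin_l | exact: Rmin_r].
have [/= hxu hyv] := hd x y hx1 hy1.
have du : Rabs (flow a x y - flow a u y) <= L * Rabs (x - u).
  apply: (@lipschitz_of_derive (fun t => flow a t y)
            (fun t => \rsum_(b < n) (A a b t y * flow b t y))) => t ht.
    by apply: flow_derive_u; split=> //; exact: between_dist hu hxu ht.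
  apply: Rle_trans L_ge; apply: (@A_flow_bound a t y).
  by split=> //; exact: between_dist hu hxu ht.
have dv : Rabs (flow a u y - flow a u v) <= L * Rabs (y - v).
  apply: (@lipschitz_of_derive (fun t => flow a u t)
            (fun t => \rsum_(b < n) (B a b u t * flow b u t))) => t ht.
    by apply: flow_derive_v; split=> //; exact: between_dist hv hyv ht.
  have Sut : S (u, t) by split=> //; exact: between_dist hv hyv ht.
  by apply: Rle_trans L_ge; apply: Rabs_lin_le => b; [exact: B_le | exact: flow_bound].
have e_half : eps / (2 * L) * L = eps / 2 by field; lra.
have := Rmult_lt_compat_r L _ _ L_gt0 hx2; have := Rmult_lt_compat_r L _ _ L_gt0 hy2.
rewrite e_half.
have := Rabs_triang (flow a x y - flow a u y) (flow a u y - flow a u v).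
rewrite (_ : _ + _ = flow a x y - flow a u v); last ring.
lra.
Qed.

Lemma flow_smooth a : smooth_on S (flow a).
Proof.
apply: (smooth_of_linear_system (@square_open u0 v0 r) A_smooth B_smooth).
- exact: flow_continuity.
- exact: flow_derive_u.
- exact: flow_derive_v.
Qed.

Lemma flow_init a : flow a u0 v0 = c a.
Proof. by rewrite flow_axis // axis_flow_init. Qed.

End IntegrableSystem.

Lemma smooth_on_sub (D E : R * R -> Prop) f :
  (forall p, E p -> D p) -> smooth_on D f -> smooth_on E f.
Proof. by move=> ED fs n u v Euv; apply: fs; exact: ED. Qed.

Lemma square_sub u0 v0 r r' : r' <= r -> forall p, square u0 v0 r' p -> square u0 v0 r p.
Proof. by move=> rr' p [h1 h2]; split; lra. Qed.

(** A radius small enough to serve at once as half-side of the square and, through its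
    inverse, as bound of the function. *)
Lemma smooth_locally_bounded (D : R * R -> Prop) f u v : open D -> D (u, v) -> smooth_on D f ->
  exists d, 0 < d /\ forall p, square u v d p -> D p /\ Rabs (f p.1 p.2) <= / d.
Proof.
move=> oD Duv fs; have [d1 hd1] := open_locally_2d oD Duv.
have [d2 hd2] := smooth_continuity fs Duv (mkposreal 1 Rlt_0_1).
have k_gt0 : 0 < Rabs (f u v) + 1 by have := Rabs_pos (f u v); lra.
have d0 : 0 < Rmin d1 (Rmin d2 (/ (Rabs (f u v) + 1))).
  apply: Rmin_pos; first exact: cond_pos.
  by apply: Rmin_pos; [exact: cond_pos | exact: Rinv_0_lt_compat].
exists (Rmin d1 (Rmin d2 (/ (Rabs (f u v) + 1)))); split=> // - [x y] [/= hx hy].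
have m1 := Rmin_l d1 (Rmin d2 (/ (Rabs (f u v) + 1))).
have m2 := Rmin_r d1 (Rmin d2 (/ (Rabs (f u v) + 1))).
have m3 := Rmin_l d2 (/ (Rabs (f u v) + 1)).
have m4 := Rmin_r d2 (/ (Rabs (f u v) + 1)).
split; first by apply: hd1; lra.
apply: (Rle_trans _ (Rabs (f u v) + 1)).
  have /= := hd2 x y ltac:(lra) ltac:(lra).
  have := Rabs_triang (f x y - f u v) (f u v).
  by rewrite (_ : f x y - f u v + f u v = f x y); [lra | ring].
rewrite -[X in X <= _]Rinv_inv; apply: Rinv_le_contravar => //; lra.
Qed.

(** Local solvability of a compatible (flat) skew system, a Frobenius theorem; the same
    square serves for all initial values. *)
Theorem integrable_skew_system n (A B : 'I_n -> 'I_n -> R -> R -> R)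
    (D : R * R -> Prop) u0 v0 :
  open D -> D (u0, v0) ->
  (forall a b, smooth_on D (A a b)) -> (forall a b, smooth_on D (B a b)) ->
  (forall a b u v, D (u, v) -> A a b u v = - A b a u v) ->
  (forall a b u v, D (u, v) -> B a b u v = - B b a u v) ->
  (forall a b u v, D (u, v) ->
    Dv (A a b) u v + \rsum_(c < n) (A a c u v * B c b u v)
    = Du (B a b) u v + \rsum_(c < n) (B a c u v * A c b u v)) ->
  exists r, 0 < r /\ (forall p, square u0 v0 r p -> D p) /\
  forall c : 'I_n -> R, exists z : 'I_n -> R -> R -> R,
    (forall a, smooth_on (square u0 v0 r) (z a)) /\
    (forall a, z a u0 v0 = c a) /\
    (forall a u v, square u0 v0 r (u, v) ->
       is_derive (fun t => z a t v) u (\rsum_(b < n) (A a b u v * z b u v)) /\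
       is_derive (fun t => z a u t) v (\rsum_(b < n) (B a b u v * z b u v))).
Proof.
move=> oD D0 As Bs A_skew B_skew flat.
pose F (i : 'I_n * 'I_n) (k : 'I_4) : R -> R -> R :=
  nth (A i.1 i.2) [:: A i.1 i.2; B i.1 i.2; Du (B i.1 i.2); Du (Du (B i.1 i.2))] k.
have Fs i k : smooth_on D (F i k).
  have Bu := smooth_Du (Bs i.1 i.2); have Buu := smooth_Du Bu.
  by rewrite /F; case: k => - [|[|[|[|//]]]] /= _; [exact: As | exact: Bs | exact: Bu | exact: Buu].
have [d [d_gt0 hd]] : exists d, 0 < d /\ forall i : ('I_n * 'I_n) * 'I_4,
    forall p, square u0 v0 d p -> D p /\ Rabs (F i.1 i.2 p.1 p.2) <= / d.
  apply: uniform_radius => [i d d' [d'0 dd'] h p /(square_sub dd') /h [Dp Fp]|i].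
    split=> //; apply: Rle_trans Fp _; exact: Rinv_le_contravar.
  exact: smooth_locally_bounded.
have [e [e_gt0 he]] := smooth_locally_bounded oD D0 (smooth_const oD 0).
pose r := Rmin e (Rmin d (d / (2 * (INR n + 1)))).
have N1_gt0 : 0 < INR n + 1 by have := pos_INR n; lra.
have r_gt0 : 0 < r.
  by apply: Rmin_pos => //; apply: Rmin_pos => //; apply: Rdiv_lt_0_compat; lra.
have rd : r <= d := Rle_trans _ _ _ (Rmin_r _ _) (Rmin_l _ _).
have sub p : square u0 v0 r p -> D p.
  by move=> /(square_sub (Rmin_l _ _)) /he [].
have F_le i k u v : square u0 v0 r (u, v) -> Rabs (F i k u v) <= / d.
  by move=> /(square_sub rd) h; have [_] := hd (i, k) (u, v) h.
exists r; split=> //; split=> // c; exists (flow A B u0 v0 c).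
have small : INR n * / d * r <= / 2.
  have rN : r <= d / (2 * (INR n + 1)) := Rle_trans _ _ _ (Rmin_r _ _) (Rmin_r _ _).
  have nd : 0 <= INR n * / d.
    by apply: Rmult_le_pos; [exact: pos_INR | left; exact: Rinv_0_lt_compat].
  apply: Rle_trans (Rmult_le_compat_l _ _ _ nd rN) _.
  rewrite (_ : _ * _ = INR n * / (INR n + 1) * / 2); last by field; lra.
  rewrite -[X in _ <= X]Rmult_1_l; apply: Rmult_le_compat_r; first lra.
  by have := Rinv_0_lt_compat _ N1_gt0; have := Rinv_r (INR n + 1); lra.
have As' a b := smooth_on_sub sub (As a b); have Bs' a b := smooth_on_sub sub (Bs a b).
have Ask a b u v : square u0 v0 r (u, v) -> A a b u v = - A b a u v.
  by move=> /sub; exact: A_skew.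
have Bsk a b u v : square u0 v0 r (u, v) -> B a b u v = - B b a u v.
  by move=> /sub; exact: B_skew.
have fl a b u v (h : square u0 v0 r (u, v)) := flat a b u v (sub _ h).
have Ale a b u v := @F_le (a, b) (@Ordinal 4 0 isT) u v.
have Ble a b u v := @F_le (a, b) (@Ordinal 4 1 isT) u v.
have Bule a b u v := @F_le (a, b) (@Ordinal 4 2 isT) u v.
have Buule a b u v := @F_le (a, b) (@Ordinal 4 3 isT) u v.
split; [|split].
- by move=> a; apply: flow_smooth; eassumption.
- by move=> a; apply: flow_init; eassumption.
- by move=> a u v Suv; split; [apply: flow_derive_u | apply: flow_derive_v]; eassumption.
Qed.

(** * Squares are domains *)

Lemma convex_comb_gt0 a b t : 0 < a -> 0 < b -> 0 <= t <= 1 -> 0 < (1 - t) * a + t * b.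
Proof.
move=> a0 b0 [t0 t1]; have [t_half|t_half] := Rle_lt_dec t (1 / 2).
  by apply: Rplus_lt_le_0_compat; [apply: Rmult_lt_0_compat | apply: Rmult_le_pos]; lra.
by apply: Rplus_le_lt_0_compat; [apply: Rmult_le_pos | apply: Rmult_lt_0_compat]; lra.
Qed.

Lemma square_convex u0 v0 r u v x y t :
  square u0 v0 r (u, v) -> square u0 v0 r (x, y) -> 0 <= t <= 1 ->
  square u0 v0 r (u + t * (x - u), v + t * (y - v)).
Proof.
move=> [/= /Rabs_def2 [h1 h2] /Rabs_def2 [h3 h4]] [/= /Rabs_def2 [h5 h6] /Rabs_def2 [h7 h8]] ht.
split=> /=; apply: Rabs_def1.
- have := @convex_comb_gt0 (r - (u - u0)) (r - (x - u0)) t; lra.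
- have := @convex_comb_gt0 (r + (u - u0)) (r + (x - u0)) t; lra.
- have := @convex_comb_gt0 (r - (v - v0)) (r - (y - v0)) t; lra.
- have := @convex_comb_gt0 (r + (v - v0)) (r + (y - v0)) t; lra.
Qed.

(** A separation of the square restricts to the segment joining two of its points, where
    its indicator would be a continuous function with values in [{0, 1}], against the
    intermediate value theorem. *)
Lemma square_connected u0 v0 r : connected_set (square u0 v0 r).
Proof.
move=> U V oU oV cover [[u v] [Suv Uuv]] [[x y] [Sxy Vxy]].
apply: Classical_Prop.NNPP => disj.
(* Clamping makes the path continuous on the whole line and keeps it inside the square. *)
pose clamp t := Rmax 0 (Rmin 1 t).
have clamp_in t : 0 <= clamp t <= 1.
  rewrite /clamp; split; first exact: Rmax_l.
  by apply: Rmax_lub; [lra | exact: Rmin_l].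
have clamp_lip s t : Rabs (clamp s - clamp t) <= Rabs (s - t).
  rewrite /clamp /Rmin; case: (Rle_dec 1 s) => h1; case: (Rle_dec 1 t) => h2;
    by rewrite /Rmax; repeat case: Rle_dec => ?; split_Rabs; lra.
pose path t : R * R := (u + clamp t * (x - u), v + clamp t * (y - v)).
have path_in t : square u0 v0 r (path t) by apply: square_convex.
have path_cont (W : R * R -> Prop) t : open W -> W (path t) -> locally t (fun s => W (path s)).
  move=> oW Wt; have [d hd] := open_locally_2d oW Wt.
  pose k := Rabs (x - u) + Rabs (y - v) + 1.
  have k0 : 0 < k by have := Rabs_pos (x - u); have := Rabs_pos (y - v); rewrite /k; lra.
  have dk : 0 < d / k by apply: Rdiv_lt_0_compat => //; exact: cond_pos.
  exists (mkposreal _ dk) => s hs; have {}hs : Rabs (s - t) < d / k by exact: hs.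
  have hk : Rabs (s - t) * k < d.
    have := Rmult_lt_compat_r _ _ _ k0 hs; rewrite (_ : d / k * k = d) //; field; lra.
  have := clamp_lip s t; have := Rabs_pos (s - t) => st0 cl.
  apply: hd.
    rewrite (_ : _ - _ = (clamp s - clamp t) * (x - u)); last ring.
    rewrite Rabs_mult; have := Rabs_pos (x - u); have := Rabs_pos (y - v).
    have := Rmult_le_compat_r _ _ _ (Rabs_pos (x - u)) cl; rewrite /k in hk *; nra.
  rewrite (_ : _ - _ = (clamp s - clamp t) * (y - v)); last ring.
  rewrite Rabs_mult; have := Rabs_pos (x - u); have := Rabs_pos (y - v).
  have := Rmult_le_compat_r _ _ _ (Rabs_pos (y - v)) cl; rewrite /k in hk *; nra.
pose f t := if ClassicalEpsilon.excluded_middle_informative (U (path t)) then 0 else 1.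
have f_cont : continuity f.
  move=> t; apply/continuity_pt_locally => eps.
  have [Ut|Vt] := cover _ (path_in t).
    apply: filter_imp (path_cont _ _ oU Ut) => s Us.
    rewrite /f; case: ClassicalEpsilon.excluded_middle_informative => // ?.
    case: ClassicalEpsilon.excluded_middle_informative => // ?.
    by rewrite Rminus_diag Rabs_R0; exact: cond_pos.
  apply: filter_imp (path_cont _ _ oV Vt) => s Vs.
  rewrite /f; case: ClassicalEpsilon.excluded_middle_informative => Us.
    by case: disj; exists (path s).
  case: ClassicalEpsilon.excluded_middle_informative => Ut.
    by case: disj; exists (path t).
  by rewrite Rminus_diag Rabs_R0; exact: cond_pos.
have path0 : path 0 = (u, v).
  rewrite /path (_ : clamp 0 = 0); last by rewrite /clamp Rmin_right ?Rmax_left; lra.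
  by congr pair; ring.
have path1 : path 1 = (x, y).
  rewrite /path (_ : clamp 1 = 1); last by rewrite /clamp Rmin_left ?Rmax_right; lra.
  by congr pair; ring.
have f0 : f 0 = 0.
  by rewrite /f path0; case: ClassicalEpsilon.excluded_middle_informative.
have f1 : f 1 = 1.
  rewrite /f path1; case: ClassicalEpsilon.excluded_middle_informative => // Uxy.
  by case: disj; exists (x, y).
have half_between : Rmin (f 0) (f 1) <= 1 / 2 <= Rmax (f 0) (f 1).
  by rewrite f0 f1; have := Rmin_l 0 1; have := Rmax_r 0 1; lra.
have [t [_ ft]] := IVT_gen f 0 1 (1 / 2) f_cont half_between.
move: ft; rewrite /f; case: ClassicalEpsilon.excluded_middle_informative => /= ? ?; lra.
Qed.

Lemma square_is_domain u0 v0 r : is_domain (square u0 v0 r).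
Proof. by split; [exact: square_open | exact: square_connected]. Qed.

(** * Orthonormal frames of four-space *)

Definition il : 'I_4 := @Ordinal 4 0 isT.
Definition iX : 'I_4 := @Ordinal 4 1 isT.
Definition iY : 'I_4 := @Ordinal 4 2 isT.
Definition iN : 'I_4 := @Ordinal 4 3 isT.

Lemma ord4_ind (P : 'I_4 -> Prop) : P il -> P iX -> P iY -> P iN -> forall a, P a.
Proof.
move=> h0 h1 h2 h3; case=> - [|[|[|[|//]]]] h.
- by rewrite (_ : Ordinal h = il) //; exact: val_inj.
- by rewrite (_ : Ordinal h = iX) //; exact: val_inj.
- by rewrite (_ : Ordinal h = iY) //; exact: val_inj.
- by rewrite (_ : Ordinal h = iN) //; exact: val_inj.
Qed.

Lemma Rsum4 (F : 'I_4 -> R) : \rsum_(a < 4) F a = F il + F iX + F iY + F iN.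
Proof.
have -> : il = ord0 by exact: val_inj.
have -> : iX = lift ord0 ord0 by exact: val_inj.
have -> : iY = lift ord0 (lift ord0 ord0) by exact: val_inj.
have -> : iN = lift ord0 (lift ord0 (lift ord0 ord0)) by exact: val_inj.
rewrite /rsum !big_ord_recl big_ord0 -!RplusE.
by change (GRing.zero : R) with 0; ring.
Qed.

Definition kron (a b : 'I_4) : R := if a == b then 1 else 0.

Lemma dotE x y : dot x y = \rsum_(i < 4) (x ord0 i * y ord0 i).
Proof. by []. Qed.

Lemma dotC x y : dot x y = dot y x.
Proof. by rewrite !dotE; apply: eq_Rsum => i; exact: Rmult_comm. Qed.

Lemma row4_eq (x y : R4) : (forall i, x ord0 i = y ord0 i) -> x = y.
Proof. by move=> xy; apply/rowP => i; exact: xy. Qed.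

Lemma scale_entry k (z : R4) i : (k *: z) ord0 i = k * z ord0 i.
Proof. by rewrite mxE. Qed.

Lemma dotZl k x y : dot (k *: x) y = k * dot x y.
Proof.
rewrite !dotE Rsum_mull; apply: eq_Rsum => i; rewrite scale_entry; exact: Rmult_assoc.
Qed.

Lemma dotZr k x y : dot x (k *: y) = k * dot x y.
Proof. by rewrite dotC dotZl dotC. Qed.

Lemma dot_ge0 x : 0 <= dot x x.
Proof. by rewrite dotE; apply: Rsum_ge0 => i; exact: Rle_0_sqr. Qed.

Lemma dot_comb (c : 'I_4 -> R) (e : 'I_4 -> R4) (w y : R4) :
  (forall i, w ord0 i = \rsum_(b < 4) (c b * e b ord0 i)) ->
  dot w y = \rsum_(b < 4) (c b * dot (e b) y).
Proof.
move=> hw; rewrite dotE.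
rewrite (eq_Rsum (G := fun i => \rsum_(b < 4) (c b * (e b ord0 i * y ord0 i)))).
  rewrite Rsum_exchange; apply: eq_Rsum => b; rewrite dotE Rsum_mull.
  by apply: eq_Rsum => i.
by move=> i; rewrite hw Rmult_comm Rsum_mull; apply: eq_Rsum => b; ring.
Qed.

Definition orthonormal_frame (e : 'I_4 -> R4) : Prop := forall a b, dot (e a) (e b) = kron a b.

Lemma Rsum_kron (F : 'I_4 -> R) a : \rsum_(b < 4) (F b * kron b a) = F a.
Proof. by rewrite Rsum4; elim/ord4_ind: a; rewrite /kron /=; ring. Qed.

(** A square matrix with orthonormal rows has orthonormal columns: a one-sided
    inverse is two-sided. *)
Lemma orthonormal_columns (m : 'I_4 -> 'I_4 -> R) :
  (forall a b, \rsum_(i < 4) (m a i * m b i) = kron a b) ->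
  forall i j, \rsum_(a < 4) (m a i * m a j) = kron i j.
Proof.
move=> rows i j; pose Q : 'M[R]_4 := \matrix_(a, i) m a i.
have QQtE a b : (Q *m Q^T)%R a b = \rsum_(k < 4) (m a k * m b k).
  by rewrite mxE; apply: eq_bigr => k _; rewrite !mxE.
have QtQE : (Q^T *m Q)%R i j = \rsum_(a < 4) (m a i * m a j).
  by rewrite mxE; apply: eq_bigr => k _; rewrite !mxE.
have QQt : (Q *m Q^T)%R = 1%:M%R.
  by apply/matrixP => a b; rewrite QQtE rows mxE /kron; case: eqP.
by rewrite -QtQE (mulmx1C QQt) mxE /kron; case: eqP.
Qed.

Lemma orthonormal_expansion e (w : R4) : orthonormal_frame e ->
  forall i, w ord0 i = \rsum_(b < 4) (dot w (e b) * e b ord0 i).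
Proof.
move=> oe i.
have cols := @orthonormal_columns (fun a i => e a ord0 i) oe.
transitivity (\rsum_(j < 4) (w ord0 j * \rsum_(b < 4) (e b ord0 j * e b ord0 i))).
  by rewrite -[LHS](@Rsum_kron (fun j => w ord0 j)); apply: eq_Rsum => j; rewrite cols.
by rewrite (@Rsum_assoc 4).
Qed.

Lemma orthonormal_eq e (w w' : R4) : orthonormal_frame e ->
  (forall a, dot w (e a) = dot w' (e a)) -> w = w'.
Proof.
move=> oe ww'; apply: row4_eq => i.
rewrite (orthonormal_expansion w oe) (orthonormal_expansion w' oe).
by apply: eq_Rsum => b; rewrite ww'.
Qed.

Lemma orthonormal_coord e c (w : R4) a : orthonormal_frame e ->
  (forall i, w ord0 i = \rsum_(b < 4) (c b * e b ord0 i)) -> dot w (e a) = c a.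
Proof.
move=> oe hw; rewrite (dot_comb _ hw) -[RHS](@Rsum_kron c).
by apply: eq_Rsum => b; rewrite oe.
Qed.

(** * Derivatives of vector fields *)

Lemma vDuE z u v i : vDu z u v ord0 i = Du (fun s t => z s t ord0 i) u v.
Proof. by rewrite mxE. Qed.

Lemma vDvE z u v i : vDv z u v ord0 i = Dv (fun s t => z s t ord0 i) u v.
Proof. by rewrite mxE. Qed.

Section VectorCalculus.

Variable D : R * R -> Prop.
Hypothesis oD : open D.
Implicit Types x y z : R -> R -> R4.

Lemma vsmooth_vDu z : vsmooth_on D z -> vsmooth_on D (vDu z).
Proof.
by move=> zs i; apply: (smooth_ext oD _ (smooth_Du (zs i))) => u v _; rewrite vDuE.
Qed.

Lemma vsmooth_vDv z : vsmooth_on D z -> vsmooth_on D (vDv z).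
Proof.
by move=> zs i; apply: (smooth_ext oD _ (smooth_Dv (zs i))) => u v _; rewrite vDvE.
Qed.

Lemma vsmooth_scale k z : smooth_on D k -> vsmooth_on D z ->
  vsmooth_on D (fun u v => k u v *: z u v).
Proof.
move=> ks zs i; apply: (smooth_ext oD _ (smooth_mult oD ks (zs i))) => u v _.
by rewrite mxE.
Qed.

Lemma vsmooth_ext x y : (forall u v, D (u, v) -> x u v = y u v) ->
  vsmooth_on D x -> vsmooth_on D y.
Proof. by move=> xy xs i; apply: (smooth_ext oD _ (xs i)) => u v Duv; rewrite xy. Qed.

Lemma vDu_ext x y u v : (forall u v, D (u, v) -> x u v = y u v) -> D (u, v) ->
  vDu x u v = vDu y u v.
Proof.
by move=> xy Duv; apply: row4_eq => i; rewrite !vDuE; apply: (Du_ext oD _ Duv) => s t Dst; rewrite xy.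
Qed.

Lemma vDv_ext x y u v : (forall u v, D (u, v) -> x u v = y u v) -> D (u, v) ->
  vDv x u v = vDv y u v.
Proof.
by move=> xy Duv; apply: row4_eq => i; rewrite !vDvE; apply: (Dv_ext oD _ Duv) => s t Dst; rewrite xy.
Qed.

Lemma vD_symm z u v : vsmooth_on D z -> D (u, v) -> vDu (vDv z) u v = vDv (vDu z) u v.
Proof.
move=> zs Duv; apply: row4_eq => i; rewrite vDuE vDvE.
rewrite (Du_ext oD (g := Dv (fun s t => z s t ord0 i)) _ Duv); last first.
  by move=> s t _; rewrite vDvE.
rewrite (Dv_ext oD (g := Du (fun s t => z s t ord0 i)) _ Duv); last first.
  by move=> s t _; rewrite vDuE.
exact: (smooth_symm oD (zs i) Duv).
Qed.

Lemma Du_mult f g u v : smooth_on D f -> smooth_on D g -> D (u, v) ->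
  Du (fun u v => f u v * g u v) u v = Du f u v * g u v + f u v * Du g u v.
Proof.
move=> fs gs Duv; rewrite /Du Derive_mult //; eexists; exact: (smooth_derive_u _ Duv).
Qed.

Lemma Dv_mult f g u v : smooth_on D f -> smooth_on D g -> D (u, v) ->
  Dv (fun u v => f u v * g u v) u v = Dv f u v * g u v + f u v * Dv g u v.
Proof.
move=> fs gs Duv; rewrite /Dv Derive_mult //; eexists; exact: (smooth_derive_v _ Duv).
Qed.

Lemma vDu_scale k z u v i : smooth_on D k -> vsmooth_on D z -> D (u, v) ->
  vDu (fun u v => k u v *: z u v) u v ord0 i
  = Du k u v * z u v ord0 i + k u v * vDu z u v ord0 i.
Proof.
move=> ks zs Duv; rewrite !vDuE -(Du_mult ks (zs i) Duv).
by apply: (Du_ext oD _ Duv) => s t _; rewrite mxE.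
Qed.

Lemma vDv_scale k z u v i : smooth_on D k -> vsmooth_on D z -> D (u, v) ->
  vDv (fun u v => k u v *: z u v) u v ord0 i
  = Dv k u v * z u v ord0 i + k u v * vDv z u v ord0 i.
Proof.
move=> ks zs Duv; rewrite !vDvE -(Dv_mult ks (zs i) Duv).
by apply: (Dv_ext oD _ Duv) => s t _; rewrite mxE.
Qed.

Lemma dot_vDu_scale k z w u v : smooth_on D k -> vsmooth_on D z -> D (u, v) ->
  dot (vDu (fun u v => k u v *: z u v) u v) w
  = Du k u v * dot (z u v) w + k u v * dot (vDu z u v) w.
Proof.
move=> ks zs Duv; rewrite !dotE !Rsum_mull Rsum_add; apply: eq_Rsum => i.
have -> := vDu_scale i ks zs Duv; ring.
Qed.

Lemma dot_vDv_scale k z w u v : smooth_on D k -> vsmooth_on D z -> D (u, v) ->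
  dot (vDv (fun u v => k u v *: z u v) u v) w
  = Dv k u v * dot (z u v) w + k u v * dot (vDv z u v) w.
Proof.
move=> ks zs Duv; rewrite !dotE !Rsum_mull Rsum_add; apply: eq_Rsum => i.
have -> := vDv_scale i ks zs Duv; ring.
Qed.

Lemma Du_dot x y u v : vsmooth_on D x -> vsmooth_on D y -> D (u, v) ->
  Du (fun u v => dot (x u v) (y u v)) u v
  = dot (vDu x u v) (y u v) + dot (x u v) (vDu y u v).
Proof.
move=> xs ys Duv; apply: is_derive_unique; rewrite !dotE Rsum_add.
apply: is_derive_Rsum => i; rewrite !vDuE.
apply: (is_derive_mult (fun t => x t v ord0 i) (fun t => y t v ord0 i)).
- exact: (smooth_derive_u (xs i) Duv).
- exact: (smooth_derive_u (ys i) Duv).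
- exact: Rmult_comm.
Qed.

Lemma Dv_dot x y u v : vsmooth_on D x -> vsmooth_on D y -> D (u, v) ->
  Dv (fun u v => dot (x u v) (y u v)) u v
  = dot (vDv x u v) (y u v) + dot (x u v) (vDv y u v).
Proof.
move=> xs ys Duv; apply: is_derive_unique; rewrite !dotE Rsum_add.
apply: is_derive_Rsum => i; rewrite !vDvE.
apply: (is_derive_mult (fun t => x u t ord0 i) (fun t => y u t ord0 i)).
- exact: (smooth_derive_v (xs i) Duv).
- exact: (smooth_derive_v (ys i) Duv).
- exact: Rmult_comm.
Qed.

Lemma dot_const_u x y k u v : vsmooth_on D x -> vsmooth_on D y ->
  (forall u v, D (u, v) -> dot (x u v) (y u v) = k) -> D (u, v) ->
  dot (vDu x u v) (y u v) = - dot (x u v) (vDu y u v).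
Proof.
move=> xs ys xyk Duv; have := Du_dot xs ys Duv.
rewrite (Du_ext oD (g := fun _ _ => k) xyk Duv) /Du Derive_const; lra.
Qed.

Lemma dot_const_v x y k u v : vsmooth_on D x -> vsmooth_on D y ->
  (forall u v, D (u, v) -> dot (x u v) (y u v) = k) -> D (u, v) ->
  dot (vDv x u v) (y u v) = - dot (x u v) (vDv y u v).
Proof.
move=> xs ys xyk Duv; have := Dv_dot xs ys Duv.
rewrite (Dv_ext oD (g := fun _ _ => k) xyk Duv) /Dv Derive_const; lra.
Qed.

End VectorCalculus.

(** * Linear independence of orthogonal vectors *)

Lemma dot_lin2 a b (w x y z : R4) :
  (forall i, w ord0 i = a * x ord0 i + b * y ord0 i) ->
  dot w z = a * dot x z + b * dot y z.
Proof.
move=> hw; rewrite !dotE !Rsum_mull Rsum_add; apply: eq_Rsum => i; rewrite hw; ring.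
Qed.

Lemma dot_eq0 (x : R4) : dot x x = 0 -> x = (GRing.zero : R4).
Proof.
move=> x0; apply: row4_eq => i; rewrite mxE.
have := @Rsum_ge_term 4 (fun j => x ord0 j * x ord0 j) i (fun j => Rle_0_sqr _).
rewrite -dotE x0 /= => le0; have ge0 := Rle_0_sqr (x ord0 i).
by apply: Rsqr_0_uniq; rewrite /Rsqr in ge0 *; lra.
Qed.

Lemma mul_row_tr (x y : R4) : x *m y^T = (dot x y)%:M.
Proof.
apply/matrixP => i j; rewrite !ord1 !mxE /= GRing.mulr1n.
by apply: eq_bigr => k _; rewrite mxE.
Qed.

Lemma row_free_pair (x y : R4) :
  0 < dot x x -> 0 < dot y y -> dot x y = 0 -> row_free (col_mx x y).
Proof.
move=> xx yy xy; apply/row_freeP.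
exists (row_mx ((/ dot x x) *: x^T) ((/ dot y y) *: y^T)).
rewrite mul_col_row -!scalemxAr !mul_row_tr xy dotC xy.
rewrite !scale_scalar_mx -!RmultE !Rmult_0_r !Rinv_l; try lra.
rewrite [RHS](@scalar_mx_block _ 1 1); congr block_mx;
  by apply/matrixP => i j; rewrite !mxE GRing.mul0rn.
Qed.

Lemma row_free_pair_gt0 (x y : R4) :
  row_free (col_mx x y) -> 0 < dot x x /\ 0 < dot y y.
Proof.
move=> /row_freeP [Q]; rewrite mul_col_mx => hQ.
have ne (z : R4) : z <> (GRing.zero : R4) -> 0 < dot z z.
  by case: (dot_ge0 z) => // /esym /dot_eq0.
split; apply: ne => z0; move: hQ; rewrite z0 mul0mx.
  move=> /matrixP /(_ (lshift 1 ord0) (lshift 1 ord0)); rewrite col_mxEu !mxE eqxx /=.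
  by move=> h; apply: R1_neq_R0; rewrite [RHS]h.
move=> /matrixP /(_ (rshift 1 ord0) (rshift 1 ord0)); rewrite col_mxEd !mxE eqxx /=.
by move=> h; apply: R1_neq_R0; rewrite [RHS]h.
Qed.

(** * The moving frame equations *)

Definition skew_table (w01 w02 w03 w12 w13 w23 : R) (a b : 'I_4) : R :=
  match nat_of_ord a, nat_of_ord b with
  | 0, 1 => w01 | 1, 0 => - w01
  | 0, 2 => w02 | 2, 0 => - w02
  | 0, 3 => w03 | 3, 0 => - w03
  | 1, 2 => w12 | 2, 1 => - w12
  | 1, 3 => w13 | 3, 1 => - w13
  | 2, 3 => w23 | 3, 2 => - w23
  | _, _ => 0
  end.

Lemma skew_tableC w01 w02 w03 w12 w13 w23 a b :
  skew_table w01 w02 w03 w12 w13 w23 a b = - skew_table w01 w02 w03 w12 w13 w23 b a.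
Proof. by elim/ord4_ind: a; elim/ord4_ind: b; rewrite /skew_table /=; ring. Qed.

Section MovingFrame.

Variables p q nu1 nu2 g1 g2 : R -> R -> R.

(** Connection matrices of the moving frame [(l, X, Y, N)], in this order of the indices:
    [X_u = - p l + g1 p Y + nu1 p N], [Y_v = - q l - g2 q X + nu2 q N], and so on. *)
Definition conn_u (a b : 'I_4) (u v : R) : R :=
  skew_table (p u v) 0 0 (g1 u v * p u v) (nu1 u v * p u v) 0 a b.

Definition conn_v (a b : 'I_4) (u v : R) : R :=
  skew_table 0 (q u v) 0 (g2 u v * q u v) 0 (nu2 u v * q u v) a b.

Lemma conn_u_skew a b u v : conn_u a b u v = - conn_u b a u v.
Proof. exact: skew_tableC. Qed.

Lemma conn_v_skew a b u v : conn_v a b u v = - conn_v b a u v.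
Proof. exact: skew_tableC. Qed.

Definition frame_equations (D : R * R -> Prop) (e : 'I_4 -> R -> R -> R4) : Prop :=
  forall a i u v, D (u, v) ->
    is_derive (fun t => e a t v ord0 i) u
      (\rsum_(b < 4) (conn_u a b u v * e b u v ord0 i)) /\
    is_derive (fun t => e a u t ord0 i) v
      (\rsum_(b < 4) (conn_v a b u v * e b u v ord0 i)).

Section OnSquare.

Variables u0 v0 r : R.
Let S := square u0 v0 r.

Lemma square_base u v : S (u, v) -> Rabs (u0 - u0) < r /\ Rabs (v0 - v0) < r.
Proof.
move=> [/= hu hv]; rewrite !Rminus_diag Rabs_R0.
by have := Rabs_pos (u - u0); split; lra.
Qed.

(** The difference of two solutions of a skew system has constant length. *)
Lemma frame_equations_unique e e' :
  frame_equations S e -> frame_equations S e' ->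
  (forall a, e a u0 v0 = e' a u0 v0) ->
  forall a u v, S (u, v) -> e a u v = e' a u v.
Proof.
move=> eqe eqe' init a u v Suv; have [u0_in v0_in] := square_base Suv.
have [/= hu hv] := Suv.
apply: row4_eq => i; apply: Rminus_diag_uniq; apply: Rabs_eq_0.
apply: Rle_antisym; last exact: Rabs_pos.
have zero_sum (x : 'I_4 -> R) : (forall b, x b = 0) -> \rsum_(b < 4) Rabs (x b) = 0.
  by move=> x0; apply: Rsum_zero => b; rewrite x0 Rabs_R0.
have on_axis b : e b u v0 ord0 i - e' b u v0 ord0 i = 0.
  apply: Rabs_eq_0; apply: Rle_antisym; last exact: Rabs_pos.
  have := @skew_energy_estimate 4 (fun a b t => conn_u a b t v0)
    (fun b t => e b t v0 ord0 i - e' b t v0 ord0 i) (fun _ _ => 0) u0 u 0 b.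
  rewrite zero_sum => [|j]; last by rewrite init Rminus_diag.
  rewrite Rmult_0_r Rmult_0_l Rplus_0_r; apply.
  - by move=> *; exact: conn_u_skew.
  - move=> j s hs; have Ss : S (s, v0) by split=> //; exact: between_dist u0_in hu hs.
    rewrite Rplus_0_r (eq_Rsum (fun k => Rmult_minus_distr_l _ _ _)) -Rsum_sub.
    by apply: (@is_derive_minus _ R_NormedModule); [case: (eqe j i _ _ Ss) | case: (eqe' j i _ _ Ss)].
  - by move=> *; rewrite Rabs_R0; exact: Rle_refl.
have := @skew_energy_estimate 4 (fun a b t => conn_v a b u t)
  (fun b t => e b u t ord0 i - e' b u t ord0 i) (fun _ _ => 0) v0 v 0 a.
rewrite zero_sum // Rmult_0_r Rmult_0_l Rplus_0_r; apply.
- by move=> *; exact: conn_v_skew.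
- move=> j s hs; have Ss : S (u, s) by split=> //; exact: between_dist v0_in hv hs.
  rewrite Rplus_0_r (eq_Rsum (fun k => Rmult_minus_distr_l _ _ _)) -Rsum_sub.
  by apply: (@is_derive_minus _ R_NormedModule); [case: (eqe j i _ _ Ss) | case: (eqe' j i _ _ Ss)].
- by move=> *; rewrite Rabs_R0; exact: Rle_refl.
Qed.

(** Skewness makes the inner products of the columns of the frame matrix constant, while
    the inner products of its rows satisfy only a differential equation; the two kinds of
    orthonormality are equivalent. *)
Lemma frame_equations_orthonormal e :
  frame_equations S e -> orthonormal_frame (fun a => e a u0 v0) ->
  forall u v, S (u, v) -> orthonormal_frame (fun a => e a u v).
Proof.
move=> eqe init u v Suv; have [u0_in v0_in] := square_base Suv; have [/= hu hv] := Suv.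
apply: (@orthonormal_columns (fun i a => e a u v ord0 i)) => i j.
rewrite -(@orthonormal_columns (fun a i => e a u0 v0 ord0 i) init i j).
have step_u : Rabs (\rsum_(a < 4) (e a u v0 ord0 i * e a u v0 ord0 j)
     - \rsum_(a < 4) (e a u0 v0 ord0 i * e a u0 v0 ord0 j)) <= 0 * Rabs (u - u0).
  apply: (@lipschitz_of_derive (fun t => \rsum_(a < 4) (e a t v0 ord0 i * e a t v0 ord0 j))
            (fun=> 0)) => s hs; last by rewrite Rabs_R0; exact: Rle_refl.
  have Ss : S (s, v0) by split=> //; exact: between_dist u0_in hu hs.
  rewrite -(@skew_pairing 4 (fun a b => conn_u a b s v0) (fun a => e a s v0 ord0 i)
       (fun a => e a s v0 ord0 j) (fun a b => conn_u_skew a b s v0)) Rsum_add.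
  apply: is_derive_Rsum => a; apply: (is_derive_mult (fun t => e a t v0 ord0 i) (fun t => e a t v0 ord0 j)).
  - by case: (eqe a i _ _ Ss).
  - by case: (eqe a j _ _ Ss).
  - exact: Rmult_comm.
have step_v : Rabs (\rsum_(a < 4) (e a u v ord0 i * e a u v ord0 j)
     - \rsum_(a < 4) (e a u v0 ord0 i * e a u v0 ord0 j)) <= 0 * Rabs (v - v0).
  apply: (@lipschitz_of_derive (fun t => \rsum_(a < 4) (e a u t ord0 i * e a u t ord0 j))
            (fun=> 0)) => s hs; last by rewrite Rabs_R0; exact: Rle_refl.
  have Ss : S (u, s) by split=> //; exact: between_dist v0_in hv hs.
  rewrite -(@skew_pairing 4 (fun a b => conn_v a b u s) (fun a => e a u s ord0 i)
       (fun a => e a u s ord0 j) (fun a b => conn_v_skew a b u s)) Rsum_add.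
  apply: is_derive_Rsum => a; apply: (is_derive_mult (fun t => e a u t ord0 i) (fun t => e a u t ord0 j)).
  - by case: (eqe a i _ _ Ss).
  - by case: (eqe a j _ _ Ss).
  - exact: Rmult_comm.
move: step_u step_v; rewrite !Rmult_0_l => step_u step_v.
by move: step_u step_v; split_Rabs; lra.
Qed.

End OnSquare.

(** [p] and [q] stand for the square roots of the metric coefficients [E] and [G].  The
    fields [cg_pv], [cg_qu] express that [g1], [g2] are the geodesic curvatures of the
    coordinate lines, [cg_nu1v], [cg_nu2u] are the Codazzi equations and [cg_gauss] is
    the Gauss equation. *)
Record codazzi_gauss (D : R * R -> Prop) : Prop := CodazziGauss {
  cg_p : smooth_on D p; cg_q : smooth_on D q;
  cg_nu1 : smooth_on D nu1; cg_nu2 : smooth_on D nu2;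
  cg_g1 : smooth_on D g1; cg_g2 : smooth_on D g2;
  cg_p_gt0 : forall u v, D (u, v) -> 0 < p u v;
  cg_q_gt0 : forall u v, D (u, v) -> 0 < q u v;
  cg_nu : forall u v, D (u, v) -> 0 < nu1 u v - nu2 u v;
  cg_g1_neq0 : forall u v, D (u, v) -> g1 u v <> 0;
  cg_g2_neq0 : forall u v, D (u, v) -> g2 u v <> 0;
  cg_pv : forall u v, D (u, v) -> Dv p u v = - (g1 u v * p u v * q u v);
  cg_qu : forall u v, D (u, v) -> Du q u v = g2 u v * p u v * q u v;
  cg_nu1v : forall u v, D (u, v) -> Dv nu1 u v = (nu1 u v - nu2 u v) * (g1 u v * q u v);
  cg_nu2u : forall u v, D (u, v) -> Du nu2 u v = (nu1 u v - nu2 u v) * (g2 u v * p u v);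
  cg_gauss : forall u v, D (u, v) ->
    Dv g1 u v * p u v - Du g2 u v * q u v - (g1 u v ^ 2 + g2 u v ^ 2) * (p u v * q u v)
    = (1 + nu1 u v * nu2 u v) * (p u v * q u v) }.

Lemma codazzi_gauss_sub (D E : R * R -> Prop) :
  (forall x, E x -> D x) -> codazzi_gauss D -> codazzi_gauss E.
Proof.
move=> ED [] *; split; try (by apply: (smooth_on_sub ED)); by move=> u v /ED; auto.
Qed.

Section Integration.

Variable D : R * R -> Prop.
Hypothesis oD : open D.
Hypothesis cg : codazzi_gauss D.

Lemma conn_u_smooth a b : smooth_on D (conn_u a b).
Proof.
have hp := cg_p cg; have gp := smooth_mult oD (cg_g1 cg) hp.
have np := smooth_mult oD (cg_nu1 cg) hp; have c0 := smooth_const oD 0.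
have o1 := smooth_opp oD hp; have o2 := smooth_opp oD gp; have o3 := smooth_opp oD np.
have o0 := smooth_opp oD c0.
elim/ord4_ind: a; elim/ord4_ind: b;
  first [exact c0 | exact o0 | exact hp | exact o1 | exact gp | exact o2 | exact np | exact o3].
Qed.

Lemma conn_v_smooth a b : smooth_on D (conn_v a b).
Proof.
have hq := cg_q cg; have gq := smooth_mult oD (cg_g2 cg) hq.
have nq := smooth_mult oD (cg_nu2 cg) hq; have c0 := smooth_const oD 0.
have o1 := smooth_opp oD hq; have o2 := smooth_opp oD gq; have o3 := smooth_opp oD nq.
have o0 := smooth_opp oD c0.
elim/ord4_ind: a; elim/ord4_ind: b;
  first [exact c0 | exact o0 | exact hq | exact o1 | exact gq | exact o2 | exact nq | exact o3].
Qed.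

Lemma Du_const c u v : Du (fun _ _ => c) u v = 0.
Proof. exact: Derive_const. Qed.

Lemma Dv_const c u v : Dv (fun _ _ => c) u v = 0.
Proof. exact: Derive_const. Qed.

Lemma Du_opp f u v : Du (fun u v => - f u v) u v = - Du f u v.
Proof. exact: Derive_opp. Qed.

Lemma Dv_opp f u v : Dv (fun u v => - f u v) u v = - Dv f u v.
Proof. exact: Derive_opp. Qed.

(** Entry by entry, flatness is one of the equations of [codazzi_gauss]: the entries
    [(l, X)] and [(l, Y)] give [cg_pv] and [cg_qu], the entries [(X, N)] and [(Y, N)] the
    Codazzi equations, and [(X, Y)] the Gauss equation; [(l, N)] is trivial. *)
Lemma conn_flat a b u v : D (u, v) ->
  Dv (conn_u a b) u v + \rsum_(c < 4) (conn_u a c u v * conn_v c b u v)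
  = Du (conn_v a b) u v + \rsum_(c < 4) (conn_v a c u v * conn_u c b u v).
Proof.
move=> Duv; have [hp hq h1 h2 k1 k2 _ _ _ _ _ hpv hqu hn1 hn2 hg] := cg.
have {hpv hqu hn1 hn2 hg} := (hpv _ _ Duv, hqu _ _ Duv, hn1 _ _ Duv, hn2 _ _ Duv, hg _ _ Duv).
move=> [[[[hpv hqu] hn1] hn2] hg].
have d1 : Dv (fun u v => g1 u v * p u v) u v = Dv g1 u v * p u v + g1 u v * Dv p u v.
  exact: Dv_mult k1 hp Duv.
have d2 : Dv (fun u v => nu1 u v * p u v) u v = Dv nu1 u v * p u v + nu1 u v * Dv p u v.
  exact: Dv_mult h1 hp Duv.
have d3 : Du (fun u v => g2 u v * q u v) u v = Du g2 u v * q u v + g2 u v * Du q u v.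
  exact: Du_mult k2 hq Duv.
have d4 : Du (fun u v => nu2 u v * q u v) u v = Du nu2 u v * q u v + nu2 u v * Du q u v.
  exact: Du_mult h2 hq Duv.
rewrite hpv hn1 in d1 d2; rewrite hqu hn2 in d3 d4.
rewrite !Rsum4.
elim/ord4_ind: a; elim/ord4_ind: b;
  rewrite /conn_u /conn_v /skew_table /= ?Du_opp ?Dv_opp
     ?d1 ?d2 ?d3 ?d4 ?Du_const ?Dv_const ?hpv ?hqu; lra.
Qed.

(** Each of the four coordinates of the frame vectors solves the same scalar system. *)
Lemma exists_moving_frame u0 v0 : D (u0, v0) ->
  exists r, 0 < r /\ (forall x, square u0 v0 r x -> D x) /\
  forall e0 : 'I_4 -> R4, exists e : 'I_4 -> R -> R -> R4,
    (forall a, vsmooth_on (square u0 v0 r) (e a)) /\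
    (forall a, e a u0 v0 = e0 a) /\ frame_equations (square u0 v0 r) e.
Proof.
move=> D0.
have [r [r0 [sub ex]]] := integrable_skew_system oD D0 conn_u_smooth conn_v_smooth
  (fun a b u v _ => conn_u_skew a b u v) (fun a b u v _ => conn_v_skew a b u v) conn_flat.
exists r; split=> //; split=> // e0.
have [z hz] := fin_all_exists (fun i : 'I_4 => ex (fun a => e0 a ord0 i)).
pose e a u v : R4 := \row_i z i a u v.
have eE a i u v : e a u v ord0 i = z i a u v by rewrite mxE.
exists e; split; [|split].
- move=> a i; have [zs _] := hz i.
  by apply: (smooth_ext (@square_open u0 v0 r) _ (zs a)) => u v _; rewrite eE.
- by move=> a; apply: row4_eq => i; rewrite mxE; case: (hz i) => _ [].
- move=> a i u v Suv; have [_ [_ /(_ a u v Suv) [du dv]]] := hz i.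
  split; rewrite (eq_Rsum (fun b => f_equal _ (eE b i u v))).
    by apply: is_derive_ext du => t; rewrite eE.
  by apply: is_derive_ext dv => t; rewrite eE.
Qed.

End Integration.

End MovingFrame.

(** * From moving frames to surfaces *)

Section SurfaceOfFrame.

Variables p q nu1 nu2 g1 g2 : R -> R -> R.
Variable D : R * R -> Prop.
Hypothesis oD : open D.
Hypothesis cg : codazzi_gauss p q nu1 nu2 g1 g2 D.
Variable e : 'I_4 -> R -> R -> R4.
Hypothesis e_smooth : forall a, vsmooth_on D (e a).
Hypothesis e_eq : frame_equations p q nu1 nu2 g1 g2 D e.
Hypothesis e_on : forall u v, D (u, v) -> orthonormal_frame (fun a => e a u v).

Notation l := (e il).
Notation N := (e iN).

Lemma frame_vDu a i u v : D (u, v) ->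
  vDu (e a) u v ord0 i = \rsum_(b < 4) (conn_u p nu1 g1 a b u v * e b u v ord0 i).
Proof. by move=> Duv; rewrite vDuE; apply: is_derive_unique; case: (e_eq a i Duv). Qed.

Lemma frame_vDv a i u v : D (u, v) ->
  vDv (e a) u v ord0 i = \rsum_(b < 4) (conn_v q nu2 g2 a b u v * e b u v ord0 i).
Proof. by move=> Duv; rewrite vDvE; apply: is_derive_unique; case: (e_eq a i Duv). Qed.

Lemma dot_frame_vDu a b u v : D (u, v) ->
  dot (vDu (e a) u v) (e b u v) = conn_u p nu1 g1 a b u v.
Proof.
move=> Duv; apply: (orthonormal_coord (c := fun b => conn_u p nu1 g1 a b u v) b (e_on Duv)).
by move=> i; exact: frame_vDu.
Qed.

Lemma dot_frame_vDv a b u v : D (u, v) ->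
  dot (vDv (e a) u v) (e b u v) = conn_v q nu2 g2 a b u v.
Proof.
move=> Duv; apply: (orthonormal_coord (c := fun b => conn_v q nu2 g2 a b u v) b (e_on Duv)).
by move=> i; exact: frame_vDv.
Qed.

Lemma position_vDu u v : D (u, v) -> vDu l u v = p u v *: e iX u v.
Proof.
move=> Duv; apply: row4_eq => i; rewrite frame_vDu // scale_entry Rsum4 /conn_u /skew_table /=.
ring.
Qed.

Lemma position_vDv u v : D (u, v) -> vDv l u v = q u v *: e iY u v.
Proof.
move=> Duv; apply: row4_eq => i; rewrite frame_vDv // scale_entry Rsum4 /conn_v /skew_table /=.
ring.
Qed.

Lemma frame_first_E u v : D (u, v) -> first_E l u v = p u v * p u v.
Proof.
by move=> Duv; rewrite /first_E position_vDu // dotZl dotZr (e_on Duv) /kron /= Rmult_1_r.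
Qed.

Lemma frame_first_F u v : D (u, v) -> first_F l u v = 0.
Proof.
move=> Duv; rewrite /first_F position_vDu // position_vDv // dotZl dotZr (e_on Duv) /kron /=; ring.
Qed.

Lemma frame_first_G u v : D (u, v) -> first_G l u v = q u v * q u v.
Proof.
by move=> Duv; rewrite /first_G position_vDv // dotZl dotZr (e_on Duv) /kron /= Rmult_1_r.
Qed.

Lemma frame_second_e u v : D (u, v) -> second_e l N u v = nu1 u v * (p u v * p u v).
Proof.
move=> Duv; rewrite /second_e (vDu_ext oD position_vDu Duv).
rewrite (dot_vDu_scale (D := D) oD) //; last exact: cg_p cg.
rewrite dot_frame_vDu // (e_on Duv) /kron /conn_u /skew_table /=; ring.
Qed.

Lemma frame_second_f u v : D (u, v) -> second_f l N u v = 0.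
Proof.
move=> Duv; rewrite /second_f (vDv_ext oD position_vDu Duv).
rewrite (dot_vDv_scale (D := D) oD) //; last exact: cg_p cg.
rewrite dot_frame_vDv // (e_on Duv) /kron /conn_v /skew_table /=; ring.
Qed.

Lemma frame_second_g u v : D (u, v) -> second_g l N u v = nu2 u v * (q u v * q u v).
Proof.
move=> Duv; rewrite /second_g (vDv_ext oD position_vDv Duv).
rewrite (dot_vDv_scale (D := D) oD) //; last exact: cg_q cg.
rewrite dot_frame_vDv // (e_on Duv) /kron /conn_v /skew_table /=; ring.
Qed.

Lemma sqrt_first_E u v : D (u, v) -> sqrt (first_E l u v) = p u v.
Proof.
by move=> Duv; rewrite frame_first_E // sqrt_square //; left; exact: cg_p_gt0 cg _ _ Duv.
Qed.

Lemma sqrt_first_G u v : D (u, v) -> sqrt (first_G l u v) = q u v.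
Proof.
by move=> Duv; rewrite frame_first_G // sqrt_square //; left; exact: cg_q_gt0 cg _ _ Duv.
Qed.

Lemma frame_frameX u v : D (u, v) -> frameX l u v = e iX u v.
Proof.
move=> Duv; have p0 := cg_p_gt0 cg Duv.
apply: row4_eq => i; rewrite /frameX sqrt_first_E // position_vDu // !scale_entry; field; lra.
Qed.

Lemma frame_frameY u v : D (u, v) -> frameY l u v = e iY u v.
Proof.
move=> Duv; have q0 := cg_q_gt0 cg Duv.
apply: row4_eq => i; rewrite /frameY sqrt_first_G // position_vDv // !scale_entry; field; lra.
Qed.

Lemma frame_normal_curv1 u v : D (u, v) -> normal_curv1 l N u v = nu1 u v.
Proof.
move=> Duv; have p0 := cg_p_gt0 cg Duv.
rewrite /normal_curv1 frame_second_e // frame_first_E //; field; lra.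
Qed.

Lemma frame_normal_curv2 u v : D (u, v) -> normal_curv2 l N u v = nu2 u v.
Proof.
move=> Duv; have q0 := cg_q_gt0 cg Duv.
rewrite /normal_curv2 frame_second_g // frame_first_G //; field; lra.
Qed.

Lemma frame_geod_curv1 u v : D (u, v) -> geod_curv1 l u v = g1 u v.
Proof.
move=> Duv; have p0 := cg_p_gt0 cg Duv; have q0 := cg_q_gt0 cg Duv; have ps := cg_p cg.
rewrite /geod_curv1 sqrt_first_G // frame_first_E // (Dv_ext oD frame_first_E Duv).
rewrite (Dv_mult ps ps Duv) (cg_pv cg Duv); field; lra.
Qed.

Lemma frame_geod_curv2 u v : D (u, v) -> geod_curv2 l u v = g2 u v.
Proof.
move=> Duv; have p0 := cg_p_gt0 cg Duv; have q0 := cg_q_gt0 cg Duv; have qs := cg_q cg.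
rewrite /geod_curv2 sqrt_first_E // frame_first_G // (Du_ext oD frame_first_G Duv).
rewrite (Du_mult qs qs Duv) (cg_qu cg Duv); field; lra.
Qed.

Lemma frame_regular : regular_surface_in_S3 D l N.
Proof.
split=> //; try by move=> u v Duv; rewrite (e_on Duv).
- move=> u v Duv; have p0 := cg_p_gt0 cg Duv; have q0 := cg_q_gt0 cg Duv.
  apply: row_free_pair.
  + by rewrite -/(first_E l u v) frame_first_E //; exact: Rmult_lt_0_compat.
  + by rewrite -/(first_G l u v) frame_first_G //; exact: Rmult_lt_0_compat.
  + exact: frame_first_F.
- by move=> u v Duv; rewrite position_vDu // dotZr (e_on Duv) /kron /= Rmult_0_r.
- by move=> u v Duv; rewrite position_vDv // dotZr (e_on Duv) /kron /= Rmult_0_r.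
Qed.

Lemma surface_of_frame u0 v0 : D (u0, v0) ->
  surface_with_invariants D u0 v0 (l u0 v0) (e iX u0 v0) (e iY u0 v0) (N u0 v0)
    nu1 nu2 g1 g2 l.
Proof.
move=> D0; exists N; split; [exact: frame_regular | split; [|split; [|split]]].
- move=> u v Duv; have p0 := cg_p_gt0 cg Duv; have q0 := cg_q_gt0 cg Duv.
  split; last by split; [exact: frame_first_F | exact: frame_second_f].
  case=> k [he [_ hg]]; have nu0 := cg_nu cg Duv.
  move: he hg; rewrite frame_second_e // frame_second_g // frame_first_E // frame_first_G //.
  move=> /Rmult_eq_reg_r he /Rmult_eq_reg_r hg.
  have pp := Rmult_lt_0_compat _ _ p0 p0; have qq := Rmult_lt_0_compat _ _ q0 q0.
  have := he ltac:(lra); have := hg ltac:(lra); lra.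
- move=> u v Duv; have nu0 := cg_nu cg Duv.
  rewrite frame_normal_curv1 // frame_normal_curv2 // frame_geod_curv1 // frame_geod_curv2 //.
  apply: Rmult_integral_contrapositive_currified; last exact: cg_g2_neq0 cg _ _ Duv.
  by apply: Rmult_integral_contrapositive_currified; [lra | exact: cg_g1_neq0 cg _ _ Duv].
- by split=> //; split; [exact: frame_frameX | split; [exact: frame_frameY | ]].
- move=> u v Duv; split; [exact: frame_normal_curv1 | split; [exact: frame_normal_curv2 |]].
  by split; [exact: frame_geod_curv1 | exact: frame_geod_curv2].
Qed.

End SurfaceOfFrame.

(** * From surfaces to moving frames *)

Section FrameOfSurface.

Variables p q nu1 nu2 g1 g2 : R -> R -> R.
Variable D : R * R -> Prop.
Hypothesis oD : open D.
Hypothesis cg : codazzi_gauss p q nu1 nu2 g1 g2 D.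
Variables l N : R -> R -> R4.
Hypothesis reg : regular_surface_in_S3 D l N.
Hypothesis principal : principal_parameters l N D.
Hypothesis inv : forall u v, D (u, v) ->
  normal_curv1 l N u v = nu1 u v /\ normal_curv2 l N u v = nu2 u v /\
  geod_curv1 l u v = g1 u v /\ geod_curv2 l u v = g2 u v.

Notation lu := (vDu l).
Notation lv := (vDv l).

Let ls : vsmooth_on D l. Proof. exact: surf_smooth reg. Qed.
Let Ns : vsmooth_on D N. Proof. exact: normal_smooth reg. Qed.
Let lus : vsmooth_on D lu. Proof. exact: vsmooth_vDu. Qed.
Let lvs : vsmooth_on D lv. Proof. exact: vsmooth_vDv. Qed.

Lemma surface_E_gt0 u v : D (u, v) -> 0 < first_E l u v.
Proof. by move=> Duv; case: (row_free_pair_gt0 (surf_regular reg Duv)). Qed.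

Lemma surface_G_gt0 u v : D (u, v) -> 0 < first_G l u v.
Proof. by move=> Duv; case: (row_free_pair_gt0 (surf_regular reg Duv)). Qed.

Lemma dot_lu_lv u v : D (u, v) -> dot (lu u v) (lv u v) = 0.
Proof. by move=> Duv; case: (principal Duv) => _ []. Qed.

Lemma dot_l_lu u v : D (u, v) -> dot (l u v) (lu u v) = 0.
Proof.
by move=> Duv; have := dot_const_u oD ls ls (surf_sphere reg) Duv; rewrite dotC; lra.
Qed.

Lemma dot_l_lv u v : D (u, v) -> dot (l u v) (lv u v) = 0.
Proof.
by move=> Duv; have := dot_const_v oD ls ls (surf_sphere reg) Duv; rewrite dotC; lra.
Qed.

Lemma surface_second_e u v : D (u, v) -> second_e l N u v = nu1 u v * first_E l u v.
Proof.
move=> Duv; have [<- _] := inv Duv; have := surface_E_gt0 Duv.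
rewrite /normal_curv1 => E0; field; lra.
Qed.

Lemma surface_second_g u v : D (u, v) -> second_g l N u v = nu2 u v * first_G l u v.
Proof.
move=> Duv; have [_ [<- _]] := inv Duv; have := surface_G_gt0 Duv.
rewrite /normal_curv2 => G0; field; lra.
Qed.

Definition surface_frame (a : 'I_4) (u v : R) : R4 :=
  match nat_of_ord a with
  | 0 => l u v | 1 => frameX l u v | 2 => frameY l u v | _ => N u v
  end.

Lemma surface_frame_on u v : D (u, v) -> orthonormal_frame (fun a => surface_frame a u v).
Proof.
move=> Duv; have E0 := surface_E_gt0 Duv; have G0 := surface_G_gt0 Duv.
have sE := sqrt_lt_R0 _ E0; have sG := sqrt_lt_R0 _ G0.
have EE : dot (lu u v) (lu u v) = sqrt (first_E l u v) * sqrt (first_E l u v).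
  by rewrite sqrt_sqrt //; left.
have GG : dot (lv u v) (lv u v) = sqrt (first_G l u v) * sqrt (first_G l u v).
  by rewrite sqrt_sqrt //; left.
move: EE GG sE sG; rewrite /orthonormal_frame /surface_frame /frameX /frameY.
set sE := sqrt _; set sG := sqrt _ => EE GG sE0 sG0.
have [[ll Nl] NN] := (surf_sphere reg Duv, normal_tangent_S3 reg Duv, normal_unit reg Duv).
have [Nu Nv] := (normal_u reg Duv, normal_v reg Duv).
have [[l_u l_v] uv] := (dot_l_lu Duv, dot_l_lv Duv, dot_lu_lv Duv).
move=> a b; elim/ord4_ind: a; elim/ord4_ind: b; rewrite /kron /= ?dotZl ?dotZr //;
  try (by rewrite dotC ?ll ?Nl ?Nu ?Nv ?l_u ?l_v ?uv ?EE ?GG; try field; lra);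
  by rewrite ?ll ?Nl ?Nu ?Nv ?l_u ?l_v ?uv ?EE ?GG; try field; lra.
Qed.

Lemma surface_span_eq u v (w w' : R4) : D (u, v) ->
  dot w (l u v) = dot w' (l u v) -> dot w (lu u v) = dot w' (lu u v) ->
  dot w (lv u v) = dot w' (lv u v) -> dot w (N u v) = dot w' (N u v) -> w = w'.
Proof.
move=> Duv hl hu hv hN; apply: (orthonormal_eq (surface_frame_on Duv)) => a.
by elim/ord4_ind: a; rewrite /surface_frame /= ?dotZr // ?hu ?hv.
Qed.

(** Rodrigues' formulas: the parameters being principal, the shape operator is
    diagonal in them. *)
Lemma rodrigues_u u v : D (u, v) -> vDu N u v = Ropp (nu1 u v) *: lu u v.
Proof.
move=> Duv; have [_ [_ f0]] := principal Duv.
apply: (surface_span_eq Duv); rewrite dotZl.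
- have -> := dot_const_u oD Ns ls (normal_tangent_S3 reg) Duv.
  by rewrite (normal_u reg Duv) dotC dot_l_lu //; ring.
- have -> := dot_const_u oD Ns lus (normal_u reg) Duv.
  by rewrite dotC -/(second_e l N u v) surface_second_e // -/(first_E l u v); ring.
- have -> := dot_const_u oD Ns lvs (normal_v reg) Duv.
  by rewrite (vD_symm oD ls Duv) dotC -/(second_f l N u v) f0 dot_lu_lv //; ring.
- have := dot_const_u oD Ns Ns (normal_unit reg) Duv.
  by rewrite (dotC (lu u v)) (normal_u reg Duv) (dotC (N u v)); lra.
Qed.

Lemma rodrigues_v u v : D (u, v) -> vDv N u v = Ropp (nu2 u v) *: lv u v.
Proof.
move=> Duv; have [_ [_ f0]] := principal Duv.
apply: (surface_span_eq Duv); rewrite dotZl.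
- have -> := dot_const_v oD Ns ls (normal_tangent_S3 reg) Duv.
  by rewrite (normal_v reg Duv) dotC dot_l_lv //; ring.
- have -> := dot_const_v oD Ns lus (normal_u reg) Duv.
  by rewrite dotC -/(second_f l N u v) f0 dotC dot_lu_lv //; ring.
- have -> := dot_const_v oD Ns lvs (normal_v reg) Duv.
  by rewrite dotC -/(second_g l N u v) surface_second_g // -/(first_G l u v); ring.
- have := dot_const_v oD Ns Ns (normal_unit reg) Duv.
  by rewrite (dotC (lv u v)) (normal_v reg Duv) (dotC (N u v)); lra.
Qed.

(** Equality of the mixed derivatives of [N], read through Rodrigues' formulas. *)
Lemma surface_luv u v i : D (u, v) ->
  vDv lu u v ord0 i
  = g2 u v * p u v * lv u v ord0 i + - (g1 u v * q u v) * lu u v ord0 i.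
Proof.
move=> Duv; have nu0 := cg_nu cg Duv.
have s1 := smooth_opp oD (cg_nu1 cg); have s2 := smooth_opp oD (cg_nu2 cg).
have := f_equal (fun w : R4 => w ord0 i) (vD_symm oD Ns Duv); rewrite /=.
rewrite (vDu_ext oD rodrigues_v Duv) (vDv_ext oD rodrigues_u Duv).
rewrite (vDu_scale (D := D) oD i s2 lvs Duv) (vDv_scale (D := D) oD i s1 lus Duv).
rewrite Du_opp Dv_opp (cg_nu1v cg Duv) (cg_nu2u cg Duv) (vD_symm oD ls Duv) => h.
apply: (Rmult_eq_reg_l (nu1 u v - nu2 u v)); last lra.
by move: h; lra.
Qed.

(** The scalar product of [surface_luv] with [l_u] expresses [E_v] through [q], and the
    definition of the geodesic curvature expresses it through [sqrt G]. *)
Lemma surface_sqrt_G u v : D (u, v) -> sqrt (first_G l u v) = q u v.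
Proof.
move=> Duv; have E0 := surface_E_gt0 Duv; have sG := sqrt_lt_R0 _ (surface_G_gt0 Duv).
have g10 := cg_g1_neq0 cg Duv; have [_ [_ [hg1 _]]] := inv Duv.
move: hg1; rewrite /geod_curv1.
have -> : Dv (first_E l) u v = - (2 * (g1 u v * q u v) * first_E l u v).
  rewrite (Dv_dot lus lus Duv) (dotC (lu u v)) (dot_lin2 _ (fun i => surface_luv i Duv)).
  by rewrite (dotC (lv u v)) dot_lu_lv // -/(first_E l u v); ring.
set s := sqrt _ in sG * => hg1.
apply: (Rmult_eq_reg_l (g1 u v)) => //.
by rewrite -{1}hg1; field; lra.
Qed.

Lemma surface_sqrt_E u v : D (u, v) -> sqrt (first_E l u v) = p u v.
Proof.
move=> Duv; have G0 := surface_G_gt0 Duv; have sE := sqrt_lt_R0 _ (surface_E_gt0 Duv).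
have g20 := cg_g2_neq0 cg Duv; have [_ [_ [_ hg2]]] := inv Duv.
move: hg2; rewrite /geod_curv2.
have -> : Du (first_G l) u v = 2 * (g2 u v * p u v) * first_G l u v.
  rewrite (Du_dot lvs lvs Duv) (dotC (lv u v)) (vD_symm oD ls Duv).
  rewrite (dot_lin2 _ (fun i => surface_luv i Duv)).
  by rewrite dot_lu_lv // -/(first_G l u v); ring.
set s := sqrt _ in sE * => hg2.
apply: (Rmult_eq_reg_l (g2 u v)) => //.
by rewrite -{1}hg2; field; lra.
Qed.

Let frameXE u v : D (u, v) -> frameX l u v = (/ p u v) *: lu u v.
Proof. by move=> Duv; rewrite /frameX surface_sqrt_E. Qed.

Let frameYE u v : D (u, v) -> frameY l u v = (/ q u v) *: lv u v.
Proof. by move=> Duv; rewrite /frameY surface_sqrt_G. Qed.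

Let p_neq0 u v : D (u, v) -> p u v <> 0.
Proof. by move=> Duv; have := cg_p_gt0 cg Duv; lra. Qed.

Let q_neq0 u v : D (u, v) -> q u v <> 0.
Proof. by move=> Duv; have := cg_q_gt0 cg Duv; lra. Qed.

Let ip_smooth : smooth_on D (fun u v => / p u v).
Proof. by apply: smooth_inv => //; exact: cg_p cg. Qed.

Let iq_smooth : smooth_on D (fun u v => / q u v).
Proof. by apply: smooth_inv => //; exact: cg_q cg. Qed.

Lemma surface_frame_smooth a : vsmooth_on D (surface_frame a).
Proof.
elim/ord4_ind: a => //.
- apply: (vsmooth_ext oD _ (vsmooth_scale oD ip_smooth lus)) => u v Duv.
  by rewrite -frameXE.
- apply: (vsmooth_ext oD _ (vsmooth_scale oD iq_smooth lvs)) => u v Duv.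
  by rewrite -frameYE.
Qed.

Lemma lu_frame u v i : D (u, v) -> lu u v ord0 i = p u v * frameX l u v ord0 i :> R.
Proof. by move=> Duv; rewrite frameXE // scale_entry -Rmult_assoc Rinv_r ?Rmult_1_l //; exact: p_neq0. Qed.

Lemma lv_frame u v i : D (u, v) -> lv u v ord0 i = q u v * frameY l u v ord0 i :> R.
Proof. by move=> Duv; rewrite frameYE // scale_entry -Rmult_assoc Rinv_r ?Rmult_1_l //; exact: q_neq0. Qed.

Lemma surface_Yu u v i : D (u, v) ->
  vDu (frameY l) u v ord0 i = - (g1 u v * p u v) * frameX l u v ord0 i :> R.
Proof.
move=> Duv; have q0 := q_neq0 Duv.
rewrite (vDu_ext oD frameYE Duv) (vDu_scale (D := D) oD i iq_smooth lvs Duv).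
rewrite (vD_symm oD ls Duv) surface_luv // {1}/Du Derive_inv //; last first.
  by eexists; exact: (smooth_derive_u (cg_q cg) Duv).
rewrite -/(Du q u v) (cg_qu cg Duv) lu_frame //; field; lra.
Qed.

Lemma surface_Xv u v i : D (u, v) ->
  vDv (frameX l) u v ord0 i = g2 u v * q u v * frameY l u v ord0 i :> R.
Proof.
move=> Duv; have p0 := p_neq0 Duv.
rewrite (vDv_ext oD frameXE Duv) (vDv_scale (D := D) oD i ip_smooth lus Duv).
rewrite surface_luv // {1}/Dv Derive_inv //; last first.
  by eexists; exact: (smooth_derive_v (cg_p cg) Duv).
rewrite -/(Dv p u v) (cg_pv cg Duv) lv_frame //; field; lra.
Qed.

(** In an orthonormal frame with skew connection coefficients, three of the four
    rows of the frame equations imply the fourth. *)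
Lemma complete_skew_row (e : 'I_4 -> R4) (de : 'I_4 -> R4) (w : 'I_4 -> 'I_4 -> R) a :
  orthonormal_frame e -> (forall b c, w b c = - w c b) ->
  (forall b, dot (de a) (e b) = - dot (e a) (de b)) ->
  (forall b, b <> a -> forall i, de b ord0 i = \rsum_(c < 4) (w b c * e c ord0 i)) ->
  forall i, de a ord0 i = \rsum_(c < 4) (w a c * e c ord0 i).
Proof.
move=> oe wskew ortho rows i; rewrite (orthonormal_expansion (de a) oe i).
apply: eq_Rsum => b; congr (_ * _); have [->|/eqP nba] := eqVneq b a.
  by have := ortho a; have := wskew a a; rewrite (dotC (e a)); lra.
by rewrite ortho dotC (orthonormal_coord a oe (rows b nba)) wskew; ring.
Qed.

(** Only the derivative of [X] along [u] involves [l_uu]; skewness recovers it from the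
    other three, and likewise the derivative of [Y] along [v]. *)
Lemma surface_frame_u a u v i : D (u, v) ->
  vDu (surface_frame a) u v ord0 i
  = \rsum_(b < 4) (conn_u p nu1 g1 a b u v * surface_frame b u v ord0 i).
Proof.
move=> Duv.
have rows b : b <> iX -> forall i, vDu (surface_frame b) u v ord0 i
    = \rsum_(c < 4) (conn_u p nu1 g1 b c u v * surface_frame c u v ord0 i).
  move=> + j; elim/ord4_ind: b => // _; rewrite Rsum4 /conn_u /skew_table /surface_frame /=.
  - by rewrite lu_frame //; ring.
  - by rewrite surface_Yu //; ring.
  - by rewrite rodrigues_u // scale_entry lu_frame //; ring.
have [->|/eqP nX] := eqVneq a iX; last exact: rows.
apply: (complete_skew_row (a := iX) (de := fun a => vDu (surface_frame a) u v)
   (surface_frame_on Duv) (fun b c => conn_u_skew p nu1 g1 b c u v) _ rows) => b.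
apply: (dot_const_u oD (k := kron iX b) _ _ _ Duv); try exact: surface_frame_smooth.
by move=> s t Dst; exact: surface_frame_on.
Qed.

Lemma surface_frame_v a u v i : D (u, v) ->
  vDv (surface_frame a) u v ord0 i
  = \rsum_(b < 4) (conn_v q nu2 g2 a b u v * surface_frame b u v ord0 i).
Proof.
move=> Duv.
have rows b : b <> iY -> forall i, vDv (surface_frame b) u v ord0 i
    = \rsum_(c < 4) (conn_v q nu2 g2 b c u v * surface_frame c u v ord0 i).
  move=> + j; elim/ord4_ind: b => // _; rewrite Rsum4 /conn_v /skew_table /surface_frame /=.
  - by rewrite lv_frame //; ring.
  - by rewrite surface_Xv //; ring.
  - by rewrite rodrigues_v // scale_entry lv_frame //; ring.
have [->|/eqP nY] := eqVneq a iY; last exact: rows.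
apply: (complete_skew_row (a := iY) (de := fun a => vDv (surface_frame a) u v)
   (surface_frame_on Duv) (fun b c => conn_v_skew q nu2 g2 b c u v) _ rows) => b.
apply: (dot_const_v oD (k := kron iY b) _ _ _ Duv); try exact: surface_frame_smooth.
by move=> s t Dst; exact: surface_frame_on.
Qed.

Lemma surface_frame_equations : frame_equations p q nu1 nu2 g1 g2 D surface_frame.
Proof.
move=> a i u v Duv; rewrite -surface_frame_u // -surface_frame_v // vDuE vDvE.
by split; [apply: (smooth_derive_u (D := D)) | apply: (smooth_derive_v (D := D))] => //;
   exact: surface_frame_smooth.
Qed.

End FrameOfSurface.

(** * Metric and Codazzi-Gauss equations from the invariants *)

Section FromInvariants.

Variables (D : R * R -> Prop) (nu1 nu2 g1 g2 : R -> R -> R).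
Hypothesis oD : open D.
Hypotheses (snu1 : smooth_on D nu1) (snu2 : smooth_on D nu2).
Hypotheses (sg1 : smooth_on D g1) (sg2 : smooth_on D g2).
Hypothesis h1 : forall u v, D (u, v) ->
  nu1 u v - nu2 u v > 0 /\ g1 u v * Dv nu1 u v > 0 /\ g2 u v * Du nu2 u v > 0.
Hypothesis h21 : forall u v, D (u, v) ->
  Du (fun s t => ln (Dv nu1 s t / g1 s t)) u v = Du nu1 u v / (nu1 u v - nu2 u v) /\
  Dv (fun s t => ln (Du nu2 s t / g2 s t)) u v = - (Dv nu2 u v / (nu1 u v - nu2 u v)).
Hypothesis h22 : forall u v, D (u, v) ->
  (nu1 u v - nu2 u v) / 2 *
    (Dv (fun s t => g1 s t ^ 2) u v / Dv nu1 u v - Du (fun s t => g2 s t ^ 2) u v / Du nu2 u v)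
  - (g1 u v ^ 2 + g2 u v ^ 2) = 1 + nu1 u v * nu2 u v.

(** The Codazzi equations solved for [sqrt E] and [sqrt G]. *)
Definition sqrtE_of (u v : R) : R := Du nu2 u v / g2 u v / (nu1 u v - nu2 u v).
Definition sqrtG_of (u v : R) : R := Dv nu1 u v / g1 u v / (nu1 u v - nu2 u v).

Lemma quotient_gt0 x y : x * y > 0 -> x <> 0 /\ 0 < y / x.
Proof.
move=> xy; have x0 : x <> 0 by move=> x0; rewrite x0 in xy; lra.
split=> //; rewrite (_ : y / x = x * y * (/ x) ^ 2); last by field.
by apply: Rmult_lt_0_compat => //; apply: pow2_gt_0; exact: Rinv_neq_0_compat.
Qed.

(** Turns a prescribed logarithmic derivative of [w = (nu2)_u / g2], or of
    [w = (nu1)_v / g1], into the derivative of [sqrt E], or of [sqrt G], which is [w / k]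
    with [k = nu1 - nu2]. *)
Lemma Derive_quotient_of_log (w k : R -> R) x dw dk c :
  0 < w x -> k x <> 0 -> is_derive w x dw -> is_derive k x dk ->
  Derive (fun t => ln (w t)) x = c ->
  Derive (fun t => w t / k t) x = w x / k x * (c - dk / k x).
Proof.
move=> w0 k0 wd kd <-.
have -> : Derive (fun t => ln (w t)) x = dw / w x.
  apply: is_derive_unique; rewrite (_ : dw / w x = scal dw (/ w x)) //.
  by apply: (is_derive_comp ln w) => //; exact: is_derive_ln.
rewrite Derive_div //; [|by eexists; exact: wd|by eexists; exact: kd].
by rewrite (is_derive_unique _ _ _ wd) (is_derive_unique _ _ _ kd); field; lra.
Qed.

Lemma codazzi_gauss_of_invariants : codazzi_gauss sqrtE_of sqrtG_of nu1 nu2 g1 g2 D.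
Proof.
have g10 u v (Duv : D (u, v)) := proj1 (quotient_gt0 (proj1 (proj2 (h1 Duv)))).
have g20 u v (Duv : D (u, v)) := proj1 (quotient_gt0 (proj2 (proj2 (h1 Duv)))).
have V0 u v (Duv : D (u, v)) := proj2 (quotient_gt0 (proj1 (proj2 (h1 Duv)))).
have W0 u v (Duv : D (u, v)) := proj2 (quotient_gt0 (proj2 (proj2 (h1 Duv)))).
have nu0 u v : D (u, v) -> 0 < nu1 u v - nu2 u v by move=> Duv; case: (h1 Duv).
have Vs : smooth_on D (fun u v => Dv nu1 u v / g1 u v).
  by apply: smooth_mult => //; [exact: smooth_Dv | exact: smooth_inv].
have Ws : smooth_on D (fun u v => Du nu2 u v / g2 u v).
  by apply: smooth_mult => //; [exact: smooth_Du | exact: smooth_inv].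
have ds : smooth_on D (fun u v => nu1 u v - nu2 u v).
  by apply: smooth_plus => //; exact: smooth_opp.
have inv_s : smooth_on D (fun u v => / (nu1 u v - nu2 u v)).
  by apply: smooth_inv => // u v /nu0; lra.
have ps : smooth_on D sqrtE_of by exact: smooth_mult.
have qs : smooth_on D sqrtG_of by exact: smooth_mult.
have nu1v u v : D (u, v) -> Dv nu1 u v = (nu1 u v - nu2 u v) * (g1 u v * sqrtG_of u v).
  by move=> Duv; have := nu0 _ _ Duv; have := g10 _ _ Duv; rewrite /sqrtG_of => ? ?; field; lra.
have nu2u u v : D (u, v) -> Du nu2 u v = (nu1 u v - nu2 u v) * (g2 u v * sqrtE_of u v).
  by move=> Duv; have := nu0 _ _ Duv; have := g20 _ _ Duv; rewrite /sqrtE_of => ? ?; field; lra.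
split=> //.
- by move=> u v Duv; apply: Rdiv_lt_0_compat; [exact: W0 | exact: nu0].
- by move=> u v Duv; apply: Rdiv_lt_0_compat; [exact: V0 | exact: nu0].
- move=> u v Duv; have [_ hv] := h21 Duv; have n0 := nu0 _ _ Duv.
  have dd := @is_derive_minus _ R_NormedModule _ _ _ _ _
    (smooth_derive_v snu1 Duv) (smooth_derive_v snu2 Duv).
  have := Derive_quotient_of_log (w := fun t => Du nu2 u t / g2 u t)
    (k := fun t => nu1 u t - nu2 u t) (W0 _ _ Duv) (Rgt_not_eq _ _ n0) (smooth_derive_v Ws Duv) dd hv.
  rewrite -/(sqrtE_of u v) -/(Dv sqrtE_of u v) /minus /plus /opp /= nu1v // => ->.
  by field; lra.
- move=> u v Duv; have [hu _] := h21 Duv; have n0 := nu0 _ _ Duv.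
  have dd := @is_derive_minus _ R_NormedModule _ _ _ _ _
    (smooth_derive_u snu1 Duv) (smooth_derive_u snu2 Duv).
  have := Derive_quotient_of_log (w := fun t => Dv nu1 t v / g1 t v)
    (k := fun t => nu1 t v - nu2 t v) (V0 _ _ Duv) (Rgt_not_eq _ _ n0) (smooth_derive_u Vs Duv) dd hu.
  rewrite -/(sqrtG_of u v) -/(Du sqrtG_of u v) /minus /plus /opp /= nu2u // => ->.
  by field; lra.
- move=> u v Duv; have n0 := nu0 _ _ Duv.
  have p0 : 0 < sqrtE_of u v by apply: Rdiv_lt_0_compat; [exact: W0 | exact: nu0].
  have q0 : 0 < sqrtG_of u v by apply: Rdiv_lt_0_compat; [exact: V0 | exact: nu0].
  have g1_0 := g10 _ _ Duv; have g2_0 := g20 _ _ Duv.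
  rewrite -(h22 Duv) nu1v // nu2u //.
  have -> : Dv (fun s t => g1 s t ^ 2) u v = 2 * g1 u v * Dv g1 u v.
    rewrite (Dv_ext oD (g := fun s t => g1 s t * g1 s t) _ Duv) => [|s t _]; last by ring.
    by rewrite (Dv_mult sg1 sg1 Duv); ring.
  have -> : Du (fun s t => g2 s t ^ 2) u v = 2 * g2 u v * Du g2 u v.
    rewrite (Du_ext oD (g := fun s t => g2 s t * g2 s t) _ Duv) => [|s t _]; last by ring.
    by rewrite (Du_mult sg2 sg2 Duv); ring.
  by field; lra.
Qed.

End FromInvariants.

(** * Existence and uniqueness of the surface *)

Definition initial_frame (l0 X0 Y0 N0 : R4) (a : 'I_4) : R4 :=
  tnth [tuple l0; X0; Y0; N0] a.

Lemma initial_frame_on l0 X0 Y0 N0 :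
  right_oriented_orthonormal l0 X0 Y0 N0 -> orthonormal_frame (initial_frame l0 X0 Y0 N0).
Proof. by case=> on _ a b; have := on a b; rewrite !rowK. Qed.

Unset Implicit Arguments.

Theorem theorem2p2 (D : R * R -> Prop) (u0 v0 : R)
    (nu1 nu2 g1 g2 : R -> R -> R) (l0 X0 Y0 N0 : R4)
    (hD : is_domain D) (hD0 : D (u0, v0))
    (snu1 : smooth_on D nu1) (snu2 : smooth_on D nu2)
    (sg1 : smooth_on D g1) (sg2 : smooth_on D g2)
    (h1 : forall u v, D (u, v) ->
       nu1 u v - nu2 u v > 0 /\ g1 u v * Dv nu1 u v > 0 /\
       g2 u v * Du nu2 u v > 0)
    (h21 : forall u v, D (u, v) ->
       Du (fun s t => ln (Dv nu1 s t / g1 s t)) u v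
         = Du nu1 u v / (nu1 u v - nu2 u v) /\
       Dv (fun s t => ln (Du nu2 s t / g2 s t)) u v
         = - (Dv nu2 u v / (nu1 u v - nu2 u v)))
    (h22 : forall u v, D (u, v) ->
       (nu1 u v - nu2 u v) / 2 *
         (Dv (fun s t => g1 s t ^ 2) u v / Dv nu1 u v
          - Du (fun s t => g2 s t ^ 2) u v / Du nu2 u v)
       - (g1 u v ^ 2 + g2 u v ^ 2)
       = 1 + nu1 u v * nu2 u v)
    (hframe : right_oriented_orthonormal l0 X0 Y0 N0) :
  exists D0 : R * R -> Prop,
    is_domain D0 /\ D0 (u0, v0) /\ (forall p, D0 p -> D p) /\
    exists l : R -> R -> R4,
      surface_with_invariants D0 u0 v0 l0 X0 Y0 N0 nu1 nu2 g1 g2 l /\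
      forall l' : R -> R -> R4,
        surface_with_invariants D0 u0 v0 l0 X0 Y0 N0 nu1 nu2 g1 g2 l' ->
        forall u v, D0 (u, v) -> l' u v = l u v.
Proof.
have [oD _] := hD.
have cg := codazzi_gauss_of_invariants oD snu1 snu2 sg1 sg2 h1 h21 h22.
have [r [r0 [sub ex]]] := exists_moving_frame oD cg hD0.
have [e [es [e0 e_eq]]] := ex (initial_frame l0 X0 Y0 N0).
have oS := @square_open u0 v0 r; have S0 := square_center u0 v0 r0.
have cgS := codazzi_gauss_sub sub cg.
have e_on := frame_equations_orthonormal e_eq.
have {}e_on : forall u v, square u0 v0 r (u, v) -> orthonormal_frame (fun a => e a u v).
  by apply: e_on => a b; rewrite !e0; exact: initial_frame_on.
exists (square u0 v0 r); split; [exact: square_is_domain | split=> //; split=> //].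
exists (e il); split.
  have := surface_of_frame oS cgS es e_eq e_on S0.
  by rewrite !e0.
move=> l' [N [reg [principal [_ [[l'0 [X'0 [Y'0 N'0]]] inv]]]]] u v Suv.
have e'_eq := surface_frame_equations oS cgS reg principal inv.
apply: (frame_equations_unique e'_eq e_eq _ il Suv) => a.
by rewrite e0; elim/ord4_ind: a.
Qed.
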